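(* In the setting described in the context, assume Conditions 1, 2, 3, 7 and 8 listed there, that the eigenvalues of $n^{-1}A_n$ and $n^{-1}B_n$ are bounded away from $0$ and $\infty$, and that $d=o\{n^{(1-4r)/4}\}$. Let $$\widehat A_n=X^T\Sigma(X\widehat\beta_n)X,\qquad \widehat B_n=X^T\mathrm{diag}\{[Y-\mu(X\widehat\beta_n)]\circ[Y-\mu(X\widehat\beta_n)]\}X,\qquad \widehat H_n=\widehat A_n^{-1}\widehat B_n .$$ Then, with $H_n=A_n^{-1}B_n$, the plug-in estimator $\widehat H_n$ satisfies $\mathrm{tr}(\widehat H_n)=\mathrm{tr}(H_n)+o_P(1)$ and $\log|\widehat H_n|=\log|H_n|+o_P(1)$ as $n\to\infty$, where $|\cdot|$ of a square matrix denotes its determinant.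
   Context: Setting. For each $n$, $Y=(Y_1,\dots,Y_n)^T$ is a random vector with independent (not necessarily identically distributed) components and unknown true density $g_n(y)=\prod_{i=1}^n g_{n,i}(y_i)$; the $EY_i^2$ are bounded uniformly in $i,n$. $X=(x_{ij})$ is a deterministic $n\times d$ design matrix of full column rank $d$ (with $d=d_n$ allowed to grow), with rows $x_1^T,\dots,x_n^T$. The (possibly misspecified) working model is the generalized linear model with canonical link, with density proportional to $\exp[z^TX\beta-\mathbf 1^T\mathbf b(X\beta)]$ with respect to a fixed product measure, $\beta\in\mathbb{R}^d$, where $b:\mathbb{R}\to\mathbb{R}$ is a smooth convex function with $b''$ continuous and bounded away from $0$. For $\theta\in\mathbb{R}^n$, $\mathbf b(\theta)=(b(\theta_1),\dots,b(\theta_n))^T$, $\mu(\theta)=(b'(\theta_1),\dots,b'(\theta_n))^T$, $\Sigma(\theta)=\mathrm{diag}\{b''(\theta_1),\dots,b''(\theta_n)\}$. The quasi-log-likelihood is $\ell_n(y,\beta)=y^TX\beta-\mathbf 1^T\mathbf b(X\beta)$ (up to a term not depending on $\beta$), and the quasi-maximum likelihood estimator is $\widehat\beta_n=\arg\max_{\beta\in\mathbb{R}^d}\ell_n(Y,\beta)$. $\beta_{n,0}\in\mathbb{R}^d$ is the minimizer of the Kullback–Leibler divergence of the working model from the true model; it solves $X^T[EY-\mu(X\beta)]=0$. Put $B_n=X^T\mathrm{cov}(Y)X$, $A_n(\beta)=X^T\Sigma(X\beta)X$, $A_n=A_n(\beta_{n,0})$, $V_n(\beta)=B_n^{-1/2}A_n(\beta)B_n^{-1/2}$.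 $\|\cdot\|_2$ is the Euclidean norm of vectors and the operator norm of matrices; $\circ$ is the Hadamard (componentwise) product; the absolute value of a vector is taken componentwise; $\mathrm{diag}\{v\}$ is the diagonal matrix with diagonal $v$. Condition 1. There is a constant $H>0$ such that for each $1\le i\le n$, $P(|q_i|>t)\le H\exp(-t^2/H)$ for all $t\ge0$, where $(q_1,\dots,q_n)^T=\mathrm{cov}(Y)^{-1/2}(Y-EY)$. Condition 2. There are positive constants $c_1$, $c_0>8c_1^{-2}H$, and $r<1/4$ such that for all sufficiently large $n$, $\min_{\beta\in N_n(\delta_n)}\lambda_{\min}\{V_n(\beta)\}>c_1n^{-r}$, and $\lambda_{\min}(B_n)\gg d\delta_n^2$ (i.e. $d\delta_n^2/\lambda_{\min}(B_n)\to0$), where $\delta_n=n^r(c_0\log n)^{1/2}$ and $N_n(\delta_n)=\{\beta\in\mathbb{R}^d:\|(n^{-1}B_n)^{1/2}(\beta-\beta_{n,0})\|_2\le (n/d)^{-1/2}\delta_n\}$. Moreover $d=o\{n^{(1-4r)/3}(\log n)^{-2/3}\}$. Condition 3. $\sum_{i=1}^n(x_i^TB_n^{-1}x_i)^{3/2}=o(1)$ and $\max_{1\le i\le n}E|Y_i-EY_i|^3=O(1)$. Condition 7. The matrix-valued functions of $\beta$ given by $n^{-1}A_n(\beta)$, $n^{-1}X^T\mathrm{diag}\{|\mu(X\beta)-\mu(X\beta_{n,0})|\}X$, and $n^{-1}X^T\mathrm{diag}\{[\mu(X\beta)-\mu(X\beta_{n,0})]\circ[\mu(X\beta)-\mu(X\beta_{n,0})]\}X$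 are Lipschitz (in operator norm) with constant $L>0$ in $N_n(\delta_n)$, and $\|X\|_\infty=\max_{i,j}|x_{ij}|=O(n^{\alpha_2})$ with a constant $0\le\alpha_2<r$. Condition 8. $\sum_{i=1}^n\{[EY_i-(\mu(X\beta_{n,0}))_i]^2/\mathrm{var}(Y_i)\}^2=O(n^{\alpha_3})$ with some constant $0\le\alpha_3\le4(r-\alpha_2)$. *)

(* Defs.v *)
From HB Require Import structures.
From mathcomp Require Import all_boot all_order all_algebra.
From mathcomp Require Import all_classical all_reals all_analysis.

Set Implicit Arguments.
Unset Strict Implicit.
Unset Printing Implicit Defensive.

Import Order.TTheory GRing.Theory Num.Theory.
Import numFieldNormedType.Exports.

Local Open Scope classical_set_scope.
Local Open Scope ring_scope.

Section LinearAlgebra.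
Context {R : realType}.

Definition norm2 n (v : 'cV[R]_n) : R := Num.sqrt (\sum_i v i 0 ^+ 2).

Definition opnorm m n (M : 'M[R]_(m, n)) : R :=
  sup [set norm2 (M *m v) | v in [set v | norm2 v <= 1]].

Definition lipschitz_opnorm m n (L : R) (D : set 'cV[R]_n)
    (F : 'cV[R]_n -> 'M[R]_m) : Prop :=
  forall u v, D u -> D v -> opnorm (F u - F v) <= L * norm2 (u - v).

Definition psdmx n (M : 'M[R]_n) : Prop :=
  M^T = M /\ forall v : 'cV[R]_n, 0 <= (v^T *m M *m v) 0 0.

(* The positive semidefinite square root M^{1/2}; it exists and is unique when
   M is positive semidefinite, and the value 0 is used otherwise. *)
Definition sqrtmx n (M : 'M[R]_n) : 'M[R]_n :=
  xget 0 [set S | psdmx S /\ S *m S = M].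

Definition invsqrtmx n (M : 'M[R]_n) : 'M[R]_n := invmx (sqrtmx M).

(* Meant for symmetric matrices, whose eigenvalues are all real. *)
Definition lambda_min n (M : 'M[R]_n) : R := inf [set a | eigenvalue M a].

Definition diagc n (v : 'cV[R]_n) : 'M[R]_n := diag_mx v^T.

Definition hadamard n (u v : 'cV[R]_n) : 'cV[R]_n := \col_i (u i 0 * v i 0).

Definition absv n (v : 'cV[R]_n) : 'cV[R]_n := map_mx Num.norm v.

End LinearAlgebra.

Section Moments.
Context {R : realType} {disp : measure_display} {T : measurableType disp}.
Variables (P : probability T R) (n : nat) (Y : 'I_n -> {RV P >-> R}).

Definition rvec (w : T) : 'cV[R]_n := \col_i Y i w.

Definition meanv : 'cV[R]_n := \col_i fine 'E_P[Y i].

Definition covmx : 'M[R]_n := \matrix_(i, j) fine (covariance P (Y i) (Y j)).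

(* As the E i may be taken to be the whole line, this includes the product rule
   for all subfamilies. *)
Definition independent_family : Prop :=
  forall E : 'I_n -> set R, (forall i, measurable (E i)) ->
    P [set w | forall i, E i (Y i w)] = (\prod_(i < n) P (Y i @^-1` E i))%E.

Definition has_density (nu : {sigma_finite_measure set R -> \bar R})
    (X : {RV P >-> R}) (g : R -> R) : Prop :=
  [/\ measurable_fun setT g, forall y, 0 <= g y
    & forall E : set R, measurable E ->
        P (X @^-1` E) = (\int[nu]_(y in E) (g y)%:E)%E].

End Moments.

Section CanonicalGLM.
Context {R : realType}.
Variable b : R -> R.

(* Only the smoothness of order two is required. *)
Definition cumulant_function : Prop :=
  [/\ convex_function [set: R] b,
      (forall t, derivable b t 1) /\ (forall t, derivable (derive1 b) t 1),
      continuous (derive1n 2 b)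
    & exists2 m : R, 0 < m & forall t, m <= derive1n 2 b t].

Definition glm_mean n (theta : 'cV[R]_n) : 'cV[R]_n :=
  map_mx (derive1 b) theta.

Definition glm_cov n (theta : 'cV[R]_n) : 'M[R]_n :=
  diagc (map_mx (derive1n 2 b) theta).

Variables (n d : nat) (X : 'M[R]_(n, d)).

Definition loglik (y : 'cV[R]_n) (beta : 'cV[R]_d) : R :=
  (y^T *m X *m beta) 0 0 - \sum_i b ((X *m beta) i 0).

Definition is_QMLE (y : 'cV[R]_n) (beta : 'cV[R]_d) : Prop :=
  forall beta' : 'cV[R]_d, loglik y beta' <= loglik y beta.

(* exp(y theta - b(theta)) / kappa_i is a probability density with respect to
   nu_i for every theta: the factor kappa_i does not depend on the parameter,
   so that loglik is the log-likelihood up to an additive constant. *)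
Definition glm_normalized (nu : 'I_n -> {sigma_finite_measure set R -> \bar R})
    (kappa : 'I_n -> R) : Prop :=
  forall i, 0 < kappa i /\
    forall theta : R,
      (\int[nu i]_y (expR (y * theta - b theta))%:E = (kappa i)%:E)%E.

Definition working_density (kappa : 'I_n -> R) (y : 'cV[R]_n)
    (beta : 'cV[R]_d) : R :=
  expR (loglik y beta) / \prod_i kappa i.

Definition product_density (g : 'I_n -> R -> R) (y : 'cV[R]_n) : R :=
  \prod_i g i (y i 0).

Definition glm_info (beta : 'cV[R]_d) : 'M[R]_d :=
  X^T *m glm_cov (X *m beta) *m X.

End CanonicalGLM.

Section KullbackLeibler.
Context {R : realType} {disp : measure_display} {T : measurableType disp}.
Variables (P : probability T R) (n d : nat) (Y : 'I_n -> {RV P >-> R}).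
Variables (b : R -> R) (X : 'M[R]_(n, d)).
Variables (kappa : 'I_n -> R) (g : 'I_n -> R -> R).

(* Since Y has density g_n, the integral of g_n log (g_n / f_n) with respect to
   the product measure is the expectation of log (g_n(Y) / f_n(Y, beta)). *)
Definition KL (beta : 'cV[R]_d) : \bar R :=
  'E_P[fun w => ln (product_density g (rvec Y w) /
                    working_density b X kappa (rvec Y w) beta)%R]%E.

(* Finiteness at the minimizer excludes the degenerate case where the
   divergence is infinite for all parameters. *)
Definition is_KL_minimizer (beta : 'cV[R]_d) : Prop :=
  KL beta \is a fin_num /\ forall beta' : 'cV[R]_d, (KL beta <= KL beta')%E.

End KullbackLeibler.

Section Sequences.
Context {R : realType}.

Definition eigenvalues_bounded (d : nat -> nat)
    (M : forall n, 'M[R]_(d n)) : Prop :=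
  exists m K : R, 0 < m /\
    forall n a, eigenvalue (M n) a -> m <= a <= K.

(* Z_n -> 0 in probability, the Z_n living on possibly different spaces;
   extended values occur for the logarithm of a singular determinant. *)
Definition cvg_prob0 (disp : nat -> measure_display)
    (T : forall n, measurableType (disp n)) (P : forall n, probability (T n) R)
    (Z : forall n, T n -> \bar R) : Prop :=
  forall eps : R, 0 < eps ->
    (fun n => P n [set w | (eps%:E < `|Z n w|)%E]) @ \oo --> (0%E : \bar R).

Definition nbhd_radius (c0 r : R) (n : nat) : R :=
  n%:R `^ r * Num.sqrt (c0 * ln n%:R).

End Sequences.

Section Misspecified.
Context {R : realType} {disp : nat -> measure_display}.
Context {T : forall n, measurableType (disp n)}.
Variables (P : forall n, probability (T n) R).
Variables (Y : forall n, 'I_n -> {RV (P n) >-> R}).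
Variables (b : R -> R) (d : nat -> nat) (X : forall n, 'M[R]_(n, d n)).
Variables (beta0 : forall n, 'cV[R]_(d n)).

Definition Bmx n : 'M[R]_(d n) := (X n)^T *m covmx (@Y n) *m X n.

Definition Amx n : 'M[R]_(d n) := glm_info b (X n) (beta0 n).

Definition Vmx n (beta : 'cV[R]_(d n)) : 'M[R]_(d n) :=
  invsqrtmx (Bmx n) *m glm_info b (X n) beta *m invsqrtmx (Bmx n).

Definition noise n (w : T n) : 'cV[R]_n :=
  invsqrtmx (covmx (@Y n)) *m (rvec (@Y n) w - meanv (@Y n)).

Definition nbhd (c0 r : R) n : set 'cV[R]_(d n) :=
  [set beta | norm2 (sqrtmx (n%:R^-1 *: Bmx n) *m (beta - beta0 n))
              <= (n%:R / (d n)%:R) `^ (- (1 / 2)) * nbhd_radius c0 r n].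

Definition mean_shift n (beta : 'cV[R]_(d n)) : 'cV[R]_n :=
  glm_mean b (X n *m beta) - glm_mean b (X n *m beta0 n).

Definition leverage n (i : 'I_n) : R :=
  (row i (X n) *m invmx (Bmx n) *m (row i (X n))^T) 0 0.

Definition subgaussian_noise (H : R) : Prop :=
  0 < H /\
  forall n (i : 'I_n) (t : R), 0 <= t ->
    (P n [set w | (t < `|noise w i 0|)%R] <= (H * expR (- (t ^+ 2) / H))%:E)%E.

Definition information_growth (H c0 c1 r : R) : Prop :=
  [/\ [/\ 0 < c1, 0 < c0, 8 * c1 ^- 2 * H < c0 & 0 < r < 1 / 4],
      \forall n \near \oo, forall beta : 'cV[R]_(d n), nbhd c0 r beta ->
        c1 * n%:R `^ (- r) < lambda_min (Vmx beta),
      (fun n => (d n)%:R * nbhd_radius c0 r n ^+ 2 : R)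
        =o_\oo (fun n => lambda_min (Bmx n) : R)
    & (fun n => (d n)%:R : R)
        =o_\oo (fun n => n%:R `^ ((1 - 4 * r) / 3)
                         * (ln n%:R) `^ (- (2 / 3)) : R)].

Definition lyapunov_design : Prop :=
  (fun n => \sum_(i < n) leverage i `^ (3 / 2)) @ \oo --> (0 : R) /\
  exists K : R, \forall n \near \oo, forall i : 'I_n,
    ('E_(P n)[fun w => (`|Y i w - meanv (@Y n) i 0| ^+ 3)%R] <= K%:E)%E.

Definition lipschitz_information (c0 r L alpha : R) : Prop :=
  [/\ 0 < L,
      forall n, lipschitz_opnorm L (@nbhd c0 r n)
        (fun beta => n%:R^-1 *: glm_info b (X n) beta),
      forall n, lipschitz_opnorm L (@nbhd c0 r n)
        (fun beta => n%:R^-1 *: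
           ((X n)^T *m diagc (absv (mean_shift beta)) *m X n)),
      forall n, lipschitz_opnorm L (@nbhd c0 r n)
        (fun beta => n%:R^-1 *:
           ((X n)^T *m diagc (hadamard (mean_shift beta) (mean_shift beta))
            *m X n))
    & 0 <= alpha < r /\
      (fun n => mx_norm (X n) : R) =O_\oo (fun n => n%:R `^ alpha : R)].

Definition mean_misspecification (r alpha2 alpha3 : R) : Prop :=
  0 <= alpha3 <= 4 * (r - alpha2) /\
  (fun n => \sum_(i < n)
      ((meanv (@Y n) i 0 - glm_mean b (X n *m beta0 n) i 0) ^+ 2
       / fine 'V_(P n)[Y i]) ^+ 2 : R)
    =O_\oo (fun n => n%:R `^ alpha3 : R).

Definition Hmx n : 'M[R]_(d n) := invmx (Amx n) *m Bmx n.

Variable (betahat : forall n, T n -> 'cV[R]_(d n)).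

Definition Ahat n (w : T n) : 'M[R]_(d n) := glm_info b (X n) (betahat w).

Definition residual n (w : T n) : 'cV[R]_n :=
  rvec (@Y n) w - glm_mean b (X n *m betahat w).

Definition Bhat n (w : T n) : 'M[R]_(d n) :=
  (X n)^T *m diagc (hadamard (residual w) (residual w)) *m X n.

Definition Hhat n (w : T n) : 'M[R]_(d n) := invmx (Ahat w) *m Bhat w.

End Misspecified.

(* Main.v *)
Require Import Defs.
From HB Require Import structures.
From mathcomp Require Import all_boot all_order all_algebra.
From mathcomp Require Import all_classical all_reals all_analysis.
From mathcomp Require Import measurable_realfun.
From mathcomp Require Import ring lra.
From mathcomp Require Import complex.

Set Implicit Arguments.
Unset Strict Implicit.
Unset Printing Implicit Defensive.

Import Order.TTheory GRing.Theory Num.Theory.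
Import numFieldNormedType.Exports.

Local Open Scope classical_set_scope.
Local Open Scope ring_scope.

(** At each sample size the proof exhibits an event of probability close to one
    and compares the two matrices deterministically on it.

    Write [eps = Y - EY], [e = EY - mu(X beta0)], [m = mu(X betahat) - mu(X beta0)],
    and let [gramw X w] be the Gram matrix [X^T diag(w) X].

    - The minimizer [beta0] of the divergence maximizes the quasi-log-likelihood
      in which [Y] is replaced by [EY] ([KL_minimizer_loglik]), so that the score
      at [beta0] is [X^T eps].  The log-likelihood is concave with curvature at
      least [c1 n^-r] relative to [B_n] inside the neighbourhood, hence an
      estimator outside of it would force [norm2 (X^T eps)] to be at least of the
      order of [sqrt (d n log n)] ([QMLE_localized]).  As [X^T eps] has mean
      square [tr B_n = O(d n)], the factor [log n] in the radius makes this
      improbable by Markov's inequality.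

    - The square of the residual [eps + e - m] expands so that
      [Bhat - B = Delta + gramw X w].  Here [Delta] has the independent centered
      weights [eps^2 - var + 2 e eps], whose second moments are bounded through
      the fourth moments of the errors, so the mean square of its Frobenius norm
      is explicit ([fluct_gram_mean]).  The weights [w] are small in the weighted
      l1 norm [wnorm]: their size is controlled by [e^2] (the misspecification
      condition), and by [m] and [m^2] (the Lipschitz conditions on the
      neighbourhood) times the maximum of the errors, which is
      [O(sqrt (log n))] by sub-Gaussianity ([rest_wnorm]).

    - For an operator [M] bounded by [k / n], [tr (M Delta)] is at most
      [k sqrt d / n] times the Frobenius norm of [Delta], and [tr (M gramw X w)]
      is at most [k / n] times [wnorm X w].  These two bounds, together with
      [ln det N - ln det M <= tr (M^-1 (N - M))] for positive definite matrices
      ([ln_det_sub_le]), control both the trace and the log-determinant of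
      [Ahat^-1 Bhat] by the same quantity ([sandwich_perturbation]).  Losing only
      [sqrt d] on [Delta] and nothing on [gramw X w] is what makes the growth
      condition [d = o(n^((1-4r)/4))] suffice ([near_radius_small],
      [near_bias_small], [near_fluct_small]).

    All exceptional events are gathered in a single level set of an integrable
    function ([bad_event]), and the deviation sets are measurable, so that
    monotonicity of the probability concludes. *)

(** * Symmetric matrices *)

(** The spectral theorem over the complex numbers makes the matrix similar to a
    real diagonal one through a complex unitary matrix; two real matrices that
    are similar over the complex numbers are similar over the reals.  The real
    matrix [Q] need not be orthogonal, which [symmetric_spectral] makes up
    for. *)
Lemma symmetric_diagonalizable (R : realType) n (A : 'M[R]_n) : A^T = A ->
  exists (Q : 'M[R]_n) (a : 'rV[R]_n),
    Q \in unitmx /\ Q *m A = diag_mx a *m Q.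
Proof.
move=> As.
pose C := (R[i]%C : numClosedFieldType).
pose toC : {rmorphism R -> C} := GRing.RMorphism.clone _ _ (real_complex R) _.
have toCK x : complex.Re (toC x) = x by [].
have realP (x : C) : x \is Num.real -> toC (complex.Re x) = x.
  rewrite realE; case: x => u v /=.
  by rewrite !lecE /= => /orP[]/andP[/eqP h _]; [rewrite h | rewrite -h].
have toC_real x : toC x \is Num.real.
  by rewrite realE !lecE /= !eqxx /= le_total.
pose Ac : 'M[C]_n := map_mx toC A.
have Areal : Ac \is a mxOver Num.real.
  by apply/mxOverP => i j; rewrite mxE toC_real.
have Aherm : Ac \is hermsymmx.
  apply: realsym_hermsym => //; apply/is_hermitianmxP.
  rewrite expr0 scale1r map_mx_id //; apply/matrixP => i j.
  by rewrite !mxE -[in LHS]As mxE.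
have Dreal := hermitian_spectral_diag_real Aherm.
pose D := spectral_diag Ac.
have sim : similar_in unitmx Ac (diag_mx D).
  have /orthomx_spectralP := hermitian_normalmx Aherm.
  have := spectral_unit Ac; rewrite -/D.
  move: (spectralmx Ac) => P Punit eqA; exists P => //.
  by apply/similarP => //; rewrite eqA !mulmxA mulmxV // mul1mx.
have diagreal : diag_mx D \is a mxOver Num.real.
  apply/mxOverP => i j; rewrite mxE.
  by rewrite rpredMn // (mxOverP Dreal).
have [P /andP[Preal Punit] /(similarP Punit) PE] :=
  real_similar sim Areal diagreal.
have back m k (M : 'M[C]_(m, k)) : M \is a mxOver Num.real ->
    map_mx toC (map_mx (fun z => complex.Re z) M) = M.
  by move=> Mr; apply/matrixP => i j; rewrite !mxE realP // (mxOverP Mr).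
exists (map_mx (fun z => complex.Re z) P), (map_mx (fun z => complex.Re z) D).
split; first by rewrite -(map_unitmx toC) back.
apply: (@map_mx_inj _ _ toC).
by rewrite !map_mxM map_diag_mx !back.
Qed.

Section LinearAlgebra.
Context {R : realType}.

Definition quad n (M : 'M[R]_n) (v : 'cV[R]_n) : R := (v^T *m M *m v) 0 0.

(** A bound on the operator norm, stated without the supremum. *)
Definition opbound m n (M : 'M[R]_(m, n)) (c : R) : Prop :=
  forall v : 'cV[R]_n, norm2 (M *m v) <= c * norm2 v.

Lemma norm2_ge0 n (v : 'cV[R]_n) : 0 <= norm2 v.
Proof. exact: sqrtr_ge0. Qed.

Lemma norm2_sqr n (v : 'cV[R]_n) : norm2 v ^+ 2 = \sum_i v i 0 ^+ 2.
Proof. by rewrite sqr_sqrtr // sumr_ge0 // => i _; rewrite sqr_ge0. Qed.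

Lemma norm2_sqrM n (v : 'cV[R]_n) : norm2 v ^+ 2 = (v^T *m v) 0 0.
Proof. by rewrite norm2_sqr !mxE; apply: eq_bigr => i _; rewrite mxE expr2. Qed.

Lemma sum_sqr_eq0 (I : finType) (a : I -> R) :
  \sum_i a i ^+ 2 = 0 -> forall i, a i = 0.
Proof.
move=> /eqP; rewrite psumr_eq0 => [/allP a0 i|i _]; last exact: sqr_ge0.
by apply/eqP; rewrite -sqrf_eq0; apply: (a0 i); rewrite mem_index_enum.
Qed.

Lemma norm2_eq0 n (v : 'cV[R]_n) : norm2 v = 0 -> v = 0.
Proof.
move=> v0; apply/colP => i; rewrite mxE.
by apply: (@sum_sqr_eq0 _ (fun i => v i 0)); rewrite -norm2_sqr v0 expr0n.
Qed.

Lemma norm2Z n (a : R) (v : 'cV[R]_n) : norm2 (a *: v) = `|a| * norm2 v.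
Proof.
rewrite /norm2 -sqrtr_sqr -sqrtrM ?sqr_ge0 // mulr_sumr; congr Num.sqrt.
by apply: eq_bigr => i _; rewrite mxE exprMn.
Qed.

Lemma cauchy_schwarz (I : finType) (a b : I -> R) :
  (\sum_i a i * b i) ^+ 2 <= (\sum_i a i ^+ 2) * (\sum_i b i ^+ 2).
Proof.
set C := \sum_i a i * b i; set A := \sum_i a i ^+ 2; set B := \sum_i b i ^+ 2.
have B0 : 0 <= B by apply: sumr_ge0 => i _; apply: sqr_ge0.
have [Bz|Bn] := eqVneq B 0.
  have b0 := sum_sqr_eq0 Bz.
  suff -> : C = 0 by rewrite Bz mulr0 expr0n.
  by rewrite /C big1 // => i _; rewrite b0 mulr0.
have Bgt : 0 < B by rewrite lt0r Bn.
have : 0 <= \sum_i (B * a i - C * b i) ^+ 2.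
  by apply: sumr_ge0 => i _; apply: sqr_ge0.
have -> : \sum_i (B * a i - C * b i) ^+ 2 = B * (A * B - C ^+ 2).
  under eq_bigr => i _.
    have -> : (B * a i - C * b i) ^+ 2
        = B ^+ 2 * a i ^+ 2 - (2 * B * C) * (a i * b i) + C ^+ 2 * b i ^+ 2.
      by ring.
  over.
  rewrite big_split sumrB -!mulr_sumr -/A -/B -/C /=; ring.
by rewrite pmulr_rge0 // subr_ge0.
Qed.

Lemma dot_norm2 n (u v : 'cV[R]_n) : `|(u^T *m v) 0 0| <= norm2 u * norm2 v.
Proof.
rewrite -(ger0_norm (mulr_ge0 (norm2_ge0 u) (norm2_ge0 v))).
rewrite -ler_sqr ?nnegrE ?normr_ge0 // !real_normK ?num_real //.
rewrite exprMn !norm2_sqr.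
have -> : (u^T *m v) 0 0 = \sum_i u i 0 * v i 0.
  by rewrite mxE; apply: eq_bigr => i _; rewrite mxE.
exact: cauchy_schwarz.
Qed.

Lemma quadD n (M N : 'M[R]_n) v : quad (M + N) v = quad M v + quad N v.
Proof. by rewrite /quad mulmxDr mulmxDl mxE. Qed.

Lemma quadZ n c (M : 'M[R]_n) v : quad (c *: M) v = c * quad M v.
Proof. by rewrite /quad -scalemxAr -scalemxAl mxE. Qed.

Lemma quadN n (M : 'M[R]_n) v : quad (- M) v = - quad M v.
Proof. by rewrite -scaleN1r quadZ mulN1r. Qed.

Lemma quad_scalar n c (v : 'cV[R]_n) : quad (c%:M) v = c * norm2 v ^+ 2.
Proof. by rewrite /quad mul_mx_scalar -scalemxAl mxE norm2_sqrM. Qed.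

Lemma quad_square n m (S : 'M[R]_(m, n)) v :
  quad (S^T *m S) v = norm2 (S *m v) ^+ 2.
Proof. by rewrite norm2_sqrM /quad trmx_mul !mulmxA. Qed.

Lemma quad_norm2 n (M : 'M[R]_n) v : quad M v <= norm2 v * norm2 (M *m v).
Proof.
rewrite /quad -mulmxA; apply: le_trans (dot_norm2 _ _).
exact: ler_norm.
Qed.

Lemma opbound_quad n (M : 'M[R]_n) c v :
  opbound M c -> `|quad M v| <= c * norm2 v ^+ 2.
Proof.
move=> Mc; rewrite /quad -mulmxA; apply: le_trans (dot_norm2 _ _) _.
by rewrite expr2 mulrCA ler_wpM2l ?norm2_ge0 // Mc.
Qed.

Lemma opboundM m n p (M : 'M[R]_(m, n)) (N : 'M[R]_(n, p)) a b : 0 <= a ->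
  opbound M a -> opbound N b -> opbound (M *m N) (a * b).
Proof.
move=> a0 Ma Nb v; rewrite -mulmxA -mulrA.
by apply: le_trans (Ma _) _; rewrite ler_wpM2l.
Qed.

(** Symmetry of [A] says that [Q Q^T] commutes with the diagonal matrix, i.e.
    that its entries vanish between distinct eigenvalues; it then commutes
    with any function of the diagonal matrix as well. *)
Lemma symmetric_spectral n (A Q : 'M[R]_n) (a : 'rV[R]_n) (f : R -> R) :
  A^T = A -> Q \in unitmx -> Q *m A = diag_mx a *m Q ->
  (invmx Q *m diag_mx (map_mx f a) *m Q)^T
    = invmx Q *m diag_mx (map_mx f a) *m Q.
Proof.
move=> As Qu QA.
pose G := Q *m Q^T.
have comm : G *m diag_mx a = diag_mx a *m G.
  rewrite /G mulmxA -QA -!mulmxA -[A in RHS]As -!trmx_mul QA trmx_mul.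
  by rewrite tr_diag_mx.
have Gf : G *m diag_mx (map_mx f a) = diag_mx (map_mx f a) *m G.
  apply/matrixP => i j; move/matrixP: comm => /(_ i j).
  rewrite !mul_mx_diag !mul_diag_mx !mxE => /eqP.
  rewrite mulrC -subr_eq0 -mulrBl mulf_eq0 subr_eq0.
  by case/orP=> /eqP e; rewrite e ?mulr0 ?mul0r // mulrC.
have QTu : Q^T \in unitmx by rewrite unitmx_tr.
rewrite !trmx_mul tr_diag_mx trmx_inv.
apply: (can_inj (mulKmx Qu)).
rewrite !mulmxA mulmxV // mul1mx.
apply: (can_inj (mulmxK QTu)).
by rewrite -[in LHS](mulmxA _ (invmx _)) mulVmx // mulmx1 Gf -mulmxA.
Qed.

Lemma diagonal_eigenvalue n (A Q : 'M[R]_n) (a : 'rV[R]_n) i :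
  Q \in unitmx -> Q *m A = diag_mx a *m Q -> eigenvalue A (a 0 i).
Proof.
move=> Qu QA; apply/eigenvalueP; exists (row i Q).
  rewrite -row_mul QA; apply/rowP => j.
  by rewrite mxE mul_diag_mx !mxE.
apply/eqP => Qi0; have : row i (Q *m invmx Q) = 0 by rewrite row_mul Qi0 mul0mx.
rewrite mulmxV // => /rowP /(_ i); rewrite !mxE eqxx => /eqP.
by rewrite oner_eq0.
Qed.

(** The square root is itself the square of a symmetric fourth root, hence
    positive semidefinite. *)
Lemma symmetric_sqrt_exists n (A : 'M[R]_n) : A^T = A ->
  (forall a, eigenvalue A a -> 0 <= a) ->
  exists S : 'M[R]_n, psdmx S /\ S *m S = A.
Proof.
move=> As A0; have [Q [a [Qu QA]]] := symmetric_diagonalizable As.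
have a0 i : 0 <= a 0 i by apply: A0; apply: diagonal_eigenvalue Qu QA.
have AE : A = invmx Q *m diag_mx a *m Q by rewrite -mulmxA -QA mulKmx.
pose F (f : R -> R) := invmx Q *m diag_mx (map_mx f a) *m Q.
have Fs f : (F f)^T = F f by apply: symmetric_spectral QA.
have FM f g : F f *m F g = F (fun x => f x * g x).
  rewrite /F -!mulmxA; congr (_ *m _); rewrite mulKVmx // !mulmxA.
  congr (_ *m _).
  by apply/matrixP => i j; rewrite mul_diag_mx !mxE mulrnAr.
have Feq f g : (forall x, 0 <= x -> f x = g x) -> F f = F g.
  move=> fg; rewrite /F; congr (_ *m diag_mx _ *m _).
  by apply/rowP => i; rewrite !mxE fg.
exists (F Num.sqrt); split.
  split=> // v; rewrite -/(quad _ _).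
  have -> : F Num.sqrt = (F (fun x => Num.sqrt (Num.sqrt x)))^T
                         *m F (fun x => Num.sqrt (Num.sqrt x)).
    by rewrite Fs FM; apply: Feq => x x0; rewrite -expr2 sqr_sqrtr ?sqrtr_ge0.
  by rewrite quad_square sqr_ge0.
rewrite FM [RHS]AE (@Feq _ id) => [|x x0]; last by rewrite -expr2 sqr_sqrtr.
by rewrite /F; congr (_ *m diag_mx _ *m _); apply/rowP => i; rewrite !mxE.
Qed.

(** After shifting by [c] the matrix is the square of a symmetric matrix [S],
    so that the difference of the two sides is the squared norm of [S v]. *)
Lemma eigen_quad_ge n (A : 'M[R]_n) c : A^T = A ->
  (forall a, eigenvalue A a -> c <= a) ->
  forall v, c * norm2 v ^+ 2 <= quad A v.
Proof.
move=> As Ac v.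
have : (A - c%:M)^T = A - c%:M by rewrite linearB /= As tr_scalar_mx.
move/symmetric_sqrt_exists => [a /eigenvalueP [u uA u0]|].
  suff : c <= c + a by rewrite lerDl.
  apply: Ac; apply/eigenvalueP; exists u => //.
  by move: uA; rewrite mulmxBr mul_mx_scalar scalerDl => <-; rewrite addrC subrK.
move=> S [[Ss _] SA].
rewrite -subr_ge0 -quad_scalar -quadN -quadD -SA -{1}Ss quad_square.
exact: sqr_ge0.
Qed.

Lemma eigen_quad_le n (A : 'M[R]_n) c : A^T = A ->
  (forall a, eigenvalue A a -> a <= c) ->
  forall v, quad A v <= c * norm2 v ^+ 2.
Proof.
move=> As Ac v; rewrite -lerN2 -quadN -mulNr; apply: eigen_quad_ge.
  by rewrite linearN /= As.
move=> a /eigenvalueP [u uA u0]; rewrite lerNl; apply: Ac.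
apply/eigenvalueP; exists u => //.
by rewrite scaleNr -uA mulmxN opprK.
Qed.

Lemma psd_eigen_ge0 n (A : 'M[R]_n) a : psdmx A -> eigenvalue A a -> 0 <= a.
Proof.
move=> [_ A0] /eigenvalueP [u uA u0].
have := A0 u^T; rewrite trmxK uA -scalemxAl mxE.
have -> : (u *m u^T) 0 0 = norm2 u^T ^+ 2 by rewrite norm2_sqrM trmxK.
rewrite pmulr_lge0 // lt0r sqr_ge0 andbT expf_eq0 /=.
apply: contra u0 => /eqP /norm2_eq0 /(congr1 trmx).
by rewrite trmxK => ->; rewrite trmx0.
Qed.

Lemma sqrtmx_spec n (M : 'M[R]_n) : psdmx M ->
  psdmx (sqrtmx M) /\ sqrtmx M *m sqrtmx M = M.
Proof.
move=> Mp; rewrite /sqrtmx; case: xgetP => [S -> //|/= none].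
have [S HS] := symmetric_sqrt_exists (proj1 Mp)
  (fun a => @psd_eigen_ge0 _ M a Mp).
by case: (none S).
Qed.

Lemma sqrtmx_norm2 n (M : 'M[R]_n) v : psdmx M ->
  norm2 (sqrtmx M *m v) ^+ 2 = quad M v.
Proof.
by move=> /sqrtmx_spec [[Ss _] SM]; rewrite -quad_square Ss SM.
Qed.

Lemma trace_gram m n (M : 'M[R]_(m, n)) :
  \tr (M^T *m M) = \sum_j \sum_i M i j ^+ 2.
Proof.
rewrite /mxtrace; apply: eq_bigr => j _; rewrite mxE; apply: eq_bigr => i _.
by rewrite mxE expr2.
Qed.

Lemma trace_gram_eq0 m n (M : 'M[R]_(m, n)) : \tr (M^T *m M) = 0 -> M = 0.
Proof.
move=> /eqP; rewrite trace_gram psumr_eq0; last first.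
  by move=> j _; apply: sumr_ge0 => i _; apply: sqr_ge0.
move=> /allP M0; apply/matrixP => i j; rewrite mxE.
have /eqP := M0 j (mem_index_enum j).
by move=> /(@sum_sqr_eq0 _ (fun i => M i j)) /(_ i).
Qed.

(** With [D = S - U], the hypothesis gives [S D = - D U], whence the traces of
    the positive semidefinite matrices [D S D] and [D U D] add up to zero;
    both matrices vanish, and so does [D D = S D - U D]. *)
Lemma psd_sqrt_unique n (S U : 'M[R]_n) :
  psdmx S -> psdmx U -> S *m S = U *m U -> S = U.
Proof.
move=> Sp Up SU; set D := S - U.
have Dt : D^T = D by rewrite linearB /= (proj1 Sp) (proj1 Up).
have SD : S *m D = - (D *m U).
  by rewrite mulmxBr mulmxBl SU opprB.
have DSD : D *m S *m D = - (D *m D *m U) by rewrite -mulmxA SD mulmxN mulmxA.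
have tr0 (W : 'M[R]_n) : psdmx W -> 0 <= \tr (D *m W *m D).
  move=> Wp; have [[Vs _] VW] := sqrtmx_spec Wp.
  rewrite -VW mulmxA -mulmxA -[in X in X *m _]Dt -[in X in X *m _]Vs -trmx_mul.
  rewrite trace_gram; apply: sumr_ge0 => j _; apply: sumr_ge0 => i _.
  exact: sqr_ge0.
have trsum : \tr (D *m S *m D) + \tr (D *m U *m D) = 0.
  by rewrite DSD linearN (mxtrace_mulC (D *m U)) mulmxA addNr.
have zero (W : 'M[R]_n) : psdmx W -> \tr (D *m W *m D) = 0 -> W *m D = 0.
  move=> Wp; have [[Vs _] VW] := sqrtmx_spec Wp.
  rewrite -VW mulmxA -mulmxA -[in X in X *m _]Dt -[in X in X *m _]Vs -trmx_mul.
  by move=> /trace_gram_eq0 VD; rewrite -mulmxA VD mulmx0.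
have := tr0 S Sp; have := tr0 U Up => tU tS.
have tS0 : \tr (D *m S *m D) = 0 by lra.
have tU0 : \tr (D *m U *m D) = 0 by lra.
have DD : D *m D = 0 by rewrite {1}/D mulmxBl (zero S Sp tS0) (zero U Up tU0) subr0.
have D0 : D = 0 by apply: trace_gram_eq0; rewrite Dt DD linear0.
by apply/eqP; rewrite -subr_eq0 -/D D0.
Qed.

Lemma lambda_min_quad n (V : 'M[R]_n) c v : psdmx V -> c <= lambda_min V ->
  c * norm2 v ^+ 2 <= quad V v.
Proof.
move=> Vp cV; apply: eigen_quad_ge; first exact: (proj1 Vp).
move=> a Va; apply: le_trans cV _; apply: ge_inf => //.
by exists 0 => x /= Vx; apply: psd_eigen_ge0 Vx.
Qed.

Lemma coercive_unitmx n (M : 'M[R]_n) c : 0 < c ->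
  (forall v, c * norm2 v ^+ 2 <= quad M v) -> M \in unitmx.
Proof.
move=> c0 Mc; rewrite -row_free_unit; apply: inj_row_free => u uM.
have := Mc u^T; rewrite /quad trmxK uM mul0mx mxE pmulr_rle0 // => n0.
have /eqP : norm2 u^T ^+ 2 = 0 by apply/eqP; rewrite eq_le n0 sqr_ge0.
rewrite sqrf_eq0 => /eqP /norm2_eq0 /(congr1 trmx).
by rewrite trmxK trmx0.
Qed.

Lemma coercive_opbound_inv n (M : 'M[R]_n) c : 0 < c ->
  (forall v, c * norm2 v ^+ 2 <= quad M v) -> opbound (invmx M) c^-1.
Proof.
move=> c0 Mc v; have Mu := coercive_unitmx c0 Mc.
set u := invmx M *m v.
have [->|u0] := eqVneq (norm2 u) 0.
  by rewrite mulr_ge0 ?norm2_ge0 // invr_ge0 ltW.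
have ugt : 0 < norm2 u by rewrite lt0r u0 norm2_ge0.
rewrite ler_pdivlMl // -(ler_pM2r ugt) -mulrA -expr2.
apply: le_trans (Mc u) _.
by rewrite mulrC; apply: le_trans (quad_norm2 _ _) _; rewrite /u mulKVmx.
Qed.

Lemma diagonalized_det n (A Q : 'M[R]_n) (a : 'rV[R]_n) :
  Q \in unitmx -> Q *m A = diag_mx a *m Q -> \det A = \prod_i a 0 i.
Proof.
move=> Qu QA; have := congr1 (fun M => \det M) QA.
rewrite !det_mulmx det_diag mulrC => /mulIr -> //.
Qed.

Lemma diagonalized_trace n (A Q : 'M[R]_n) (a : 'rV[R]_n) :
  Q \in unitmx -> Q *m A = diag_mx a *m Q -> \tr A = \sum_i a 0 i.
Proof.
move=> Qu QA; rewrite -(mulKmx Qu A) QA mxtrace_mulC mulmxK //.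
by rewrite mxtrace_diag.
Qed.

Lemma coercive_eigen n (A : 'M[R]_n) c a : 0 < c ->
  (forall v, c * norm2 v ^+ 2 <= quad A v) -> eigenvalue A a -> 0 < a.
Proof.
move=> c0 Ac /eigenvalueP [u uA u0].
have un : 0 < norm2 u^T ^+ 2.
  rewrite lt0r sqr_ge0 andbT expf_eq0 /=.
  apply: contra u0 => /eqP /norm2_eq0 /(congr1 trmx).
  by rewrite trmxK => ->; rewrite trmx0.
have := Ac u^T; rewrite /quad trmxK uA -scalemxAl mxE.
have -> : (u *m u^T) 0 0 = norm2 u^T ^+ 2 by rewrite norm2_sqrM trmxK.
by rewrite ler_pM2r //; apply: lt_le_trans.
Qed.

Lemma coercive_det_gt0 n (A : 'M[R]_n) c : A^T = A -> 0 < c ->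
  (forall v, c * norm2 v ^+ 2 <= quad A v) -> 0 < \det A.
Proof.
move=> As c0 Ac; have [Q [a [Qu QA]]] := symmetric_diagonalizable As.
rewrite (diagonalized_det Qu QA); apply: prodr_gt0 => i _.
by apply: coercive_eigen c0 Ac _; apply: diagonal_eigenvalue Qu QA.
Qed.

(** In terms of the eigenvalues this is [ln x <= x - 1]. *)
Lemma ln_det_le_trace n (W : 'M[R]_n) : W^T = W ->
  (forall a, eigenvalue W a -> 0 < a) -> ln (\det W) <= \tr W - n%:R.
Proof.
move=> Ws W0; have [Q [a [Qu QA]]] := symmetric_diagonalizable Ws.
have a0 i : 0 < a 0 i by apply: W0; apply: diagonal_eigenvalue Qu QA.
rewrite (diagonalized_det Qu QA) (diagonalized_trace Qu QA).
have -> : (n%:R : R) = \sum_(i < n) 1 by rewrite sumr_const card_ord.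
rewrite -sumrB -ler_expR lnK ?posrE ?prodr_gt0 // expR_sum.
by apply: ler_prod => i _; rewrite ltW ?a0 //= -[leLHS](addrNK 1) addrC expR_ge1Dx.
Qed.

(** The tangent-plane inequality for the concave function [ln det], obtained
    by applying [ln_det_le_trace] to [M^(-1/2) N M^(-1/2)]. *)
Lemma ln_det_sub_le n (M N : 'M[R]_n) m k : M^T = M -> N^T = N ->
  0 < m -> (forall v, m * norm2 v ^+ 2 <= quad M v) ->
  0 < k -> (forall v, k * norm2 v ^+ 2 <= quad N v) ->
  ln (\det N) - ln (\det M) <= \tr (invmx M *m (N - M)).
Proof.
move=> Ms Ns m0 Mm k0 Nk.
have Mu := coercive_unitmx m0 Mm.
have Mp : psdmx M.
  split=> // v; apply: le_trans (Mm v).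
  by rewrite mulr_ge0 ?sqr_ge0 // ltW.
have [[Ss _] SM] := sqrtmx_spec Mp.
set S := sqrtmx M in Ss SM.
have Su : S \in unitmx by move: Mu; rewrite -SM unitmx_mul => /andP[].
pose W := invmx S *m N *m invmx S.
have Ws : W^T = W by rewrite /W !trmx_mul trmx_inv Ss Ns mulmxA.
have MV : invmx M = invmx S *m invmx S.
  have MI : M *m (invmx S *m invmx S) = 1%:M.
    by rewrite -SM -mulmxA mulKVmx // mulmxV.
  by rewrite -[RHS](mulKmx Mu) MI mulmx1.
have Ngt := coercive_det_gt0 Ns k0 Nk; have Mgt := coercive_det_gt0 Ms m0 Mm.
have detW : \det W = \det N / \det M.
  rewrite /W !det_mulmx -SM det_mulmx det_inv.
  rewrite invfM; ring.
have trW : \tr W = \tr (invmx M *m N) by rewrite /W mxtrace_mulC mulmxA MV.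
have Wpos a : eigenvalue W a -> 0 < a.
  move=> /eigenvalueP [u uW u0].
  have NV : quad W u^T = a * norm2 u^T ^+ 2.
    by rewrite /quad trmxK uW -scalemxAl mxE norm2_sqrM trmxK.
  have NV' : quad W u^T = quad N (invmx S *m u^T).
    by rewrite /quad trmx_mul trmx_inv Ss !mulmxA.
  have un : 0 < norm2 (invmx S *m u^T).
    rewrite lt0r norm2_ge0 andbT; apply: contra u0 => /eqP /norm2_eq0 u0.
    by rewrite -[u]trmxK -[u^T](mulKVmx Su) u0 mulmx0 trmx0.
  have un' : 0 < norm2 u^T.
    rewrite lt0r norm2_ge0 andbT; apply: contra u0 => /eqP /norm2_eq0 u0.
    by rewrite -[u]trmxK u0 trmx0.
  have := Nk (invmx S *m u^T); rewrite -NV' NV => ge.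
  have := lt_le_trans (mulr_gt0 k0 (exprn_gt0 2 un)) ge.
  by rewrite pmulr_lgt0 // exprn_gt0.
have := ln_det_le_trace Ws Wpos.
rewrite detW ln_div ?posrE // trW mulmxBr mulVmx // linearB /= mxtrace1.
by [].
Qed.

End LinearAlgebra.

(** The definition of [sqrtmx] selects some square root; uniqueness identifies
    it with the diagonal one. *)
Lemma invsqrtmx_diagc (R : realType) n (v : 'cV[R]_n) : (forall i, 0 < v i 0) ->
  invsqrtmx (diagc v) = diagc (\col_i (Num.sqrt (v i 0))^-1).
Proof.
move=> v0.
have diagM (a c : 'cV[R]_n) : diagc a *m diagc c = diagc (hadamard a c).
  by apply/matrixP => i j; rewrite mul_diag_mx !mxE mulrnAr.
have psd_diag (a : 'cV[R]_n) : (forall i, 0 <= a i 0) -> psdmx (diagc a).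
  move=> a0; split; first by rewrite tr_diag_mx.
  move=> u; rewrite -mulmxA mul_diag_mx mxE; apply: sumr_ge0 => i _.
  by rewrite !mxE mulrCA mulr_ge0 // -expr2 sqr_ge0.
pose s : 'cV[R]_n := \col_i Num.sqrt (v i 0).
have sq : sqrtmx (diagc v) = diagc s.
  have [p e] := sqrtmx_spec (psd_diag v (fun i => ltW (v0 i))).
  apply: psd_sqrt_unique => //.
    by apply: psd_diag => i; rewrite mxE sqrtr_ge0.
  rewrite e diagM; congr diagc; apply/colP => i.
  by rewrite !mxE -expr2 sqr_sqrtr // ltW.
have inv : diagc s *m diagc (\col_i (Num.sqrt (v i 0))^-1) = 1%:M.
  rewrite diagM; apply/matrixP => i j; rewrite !mxE.
  by rewrite divff // gt_eqF // sqrtr_gt0.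
rewrite /invsqrtmx sq.
have [su _] := mulmx1_unit inv.
by rewrite -[LHS]mulmx1 -inv mulKmx.
Qed.

(** * Operator bounds, Frobenius norm and weighted Gram matrices *)

Section Norms.
Context {R : realType}.

Definition frob2 m n (M : 'M[R]_(m, n)) : R := \sum_i \sum_j M i j ^+ 2.

Lemma frob2_ge0 m n (M : 'M[R]_(m, n)) : 0 <= frob2 M.
Proof. by apply: sumr_ge0 => i _; apply: sumr_ge0 => j _; apply: sqr_ge0. Qed.

Lemma frob2_le_dim n (M : 'M[R]_n) : frob2 M <= n%:R * frob2 M.
Proof.
case: n M => [|n] M; last by rewrite ler_peMl ?frob2_ge0 // ler1n.
by rewrite /frob2 big_ord0 mulr0.
Qed.

Lemma trace_mul_frob2 n (M N : 'M[R]_n) : \tr (M *m N) ^+ 2 <= frob2 M * frob2 N.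
Proof.
have -> : \tr (M *m N) = \sum_(p : 'I_n * 'I_n) M p.1 p.2 * N p.2 p.1.
  rewrite /mxtrace -(pair_bigA _ (fun i j => M i j * N j i)) /=.
  by apply: eq_bigr => i _; rewrite mxE.
apply: le_trans (cauchy_schwarz _ _) _.
rewrite -(pair_bigA _ (fun i j => M i j ^+ 2)) /=.
rewrite -(pair_bigA _ (fun i j => N j i ^+ 2)) /=.
by rewrite [X in _ * X <= _]exchange_big.
Qed.

Lemma norm2_delta n (j : 'I_n) : norm2 (delta_mx j 0 : 'cV[R]_n) = 1.
Proof.
rewrite /norm2 (bigD1 j) //= mxE !eqxx expr1n big1 ?addr0 ?sqrtr1 // => i ij.
by rewrite mxE (negPf ij) expr0n.
Qed.

Lemma opbound_frob2 m n (M : 'M[R]_(m, n)) c : 0 <= c -> opbound M c ->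
  frob2 M <= n%:R * c ^+ 2.
Proof.
move=> c0 Mc; rewrite /frob2 exchange_big /=.
have -> : (n%:R : R) * c ^+ 2 = \sum_(j < n) c ^+ 2.
  by rewrite sumr_const card_ord mulr_natl.
apply: ler_sum => j _.
have -> : \sum_i M i j ^+ 2 = norm2 (M *m delta_mx j 0) ^+ 2.
  by rewrite norm2_sqr -colE; apply: eq_bigr => i _; rewrite mxE.
rewrite ler_sqr ?nnegrE ?norm2_ge0 //.
by apply: le_trans (Mc _) _; rewrite norm2_delta mulr1.
Qed.

Lemma opbound_sqrt_frob2 m n (M : 'M[R]_(m, n)) : opbound M (Num.sqrt (frob2 M)).
Proof.
move=> v; rewrite -ler_sqr ?nnegrE ?mulr_ge0 ?norm2_ge0 ?sqrtr_ge0 //.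
rewrite exprMn (sqr_sqrtr (frob2_ge0 M)) norm2_sqr /frob2 mulr_suml.
by apply: ler_sum => i _; rewrite mxE norm2_sqr; apply: cauchy_schwarz.
Qed.

Lemma opnorm_opbound m n (M : 'M[R]_(m, n)) : opbound M (opnorm M).
Proof.
move=> v; have [v0|v0] := eqVneq (norm2 v) 0.
  rewrite v0 mulr0 (norm2_eq0 v0) mulmx0.
  by rewrite /norm2 big1 ?sqrtr0 // => i _; rewrite mxE expr0n.
have vgt : 0 < norm2 v by rewrite lt0r v0 norm2_ge0.
rewrite -ler_pdivrMr // mulrC -[X in X * _]ger0_norm ?invr_ge0 ?norm2_ge0 //.
rewrite -norm2Z scalemxAr; apply: ub_le_sup.
  exists (Num.sqrt (frob2 M)) => x /= [u u1 <-].
  apply: le_trans (opbound_sqrt_frob2 M u) _.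
  by rewrite ler_piMr ?sqrtr_ge0.
exists ((norm2 v)^-1 *: v) => //=.
by rewrite norm2Z ger0_norm ?invr_ge0 ?norm2_ge0 // mulVf.
Qed.

Lemma opbound_trace n (M : 'M[R]_n) c : opbound M c -> `|\tr M| <= n%:R * c.
Proof.
move=> Mc; apply: le_trans (ler_norm_sum _ _ _) _.
have -> : (n%:R : R) * c = \sum_(j < n) c by rewrite sumr_const card_ord mulr_natl.
apply: ler_sum => j _.
have -> : M j j = quad M (delta_mx j 0).
  by rewrite /quad -mulmxA -colE trmx_delta -rowE !mxE.
by apply: le_trans (opbound_quad _ Mc) _; rewrite norm2_delta expr1n mulr1.
Qed.

(** The Cauchy-Schwarz inequality for the Frobenius inner product; [M]
    contributes its Frobenius norm, at most [sqrt n * c]. *)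
Lemma opbound_trace_mul n (M D : 'M[R]_n) c t : 0 <= c -> 0 <= t ->
  opbound M c -> n%:R * frob2 D <= t ^+ 2 -> `|\tr (M *m D)| <= c * t.
Proof.
move=> c0 t0 Mc Dt.
rewrite -ler_sqr ?nnegrE ?normr_ge0 ?mulr_ge0 // real_normK ?num_real //.
apply: le_trans (trace_mul_frob2 _ _) _.
rewrite exprMn; apply: le_trans (ler_wpM2r (frob2_ge0 D) (opbound_frob2 c0 Mc)) _.
by rewrite -mulrA mulrCA ler_wpM2l ?sqr_ge0.
Qed.

Definition gramw m n (X : 'M[R]_(m, n)) (w : 'cV[R]_m) : 'M[R]_n :=
  X^T *m diagc w *m X.

Definition rowsq m n (X : 'M[R]_(m, n)) (i : 'I_m) : R := \sum_j X i j ^+ 2.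

(** The l1 norm of the weights, the row [i] of the design counting with its
    squared length; it bounds the nuclear norm of [gramw X w]. *)
Definition wnorm m n (X : 'M[R]_(m, n)) (w : 'cV[R]_m) : R :=
  \sum_i `|w i 0| * rowsq X i.

Variables (m n : nat) (X : 'M[R]_(m, n)).

Lemma rowsq_ge0 i : 0 <= rowsq X i.
Proof. by apply: sumr_ge0 => j _; apply: sqr_ge0. Qed.

Lemma rowsq_norm2 i : rowsq X i = norm2 (row i X)^T ^+ 2.
Proof. by rewrite norm2_sqr; apply: eq_bigr => j _; rewrite !mxE. Qed.

Lemma gramwE w i j : gramw X w i j = \sum_k w k 0 * (X k i * X k j).
Proof.
rewrite /gramw -mulmxA mul_diag_mx mxE; apply: eq_bigr => k _.
by rewrite !mxE mulrCA.
Qed.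

Lemma gramw_sym w : (gramw X w)^T = gramw X w.
Proof.
apply/matrixP => i j; rewrite [LHS]mxE !gramwE; apply: eq_bigr => k _.
by rewrite [X k j * _]mulrC.
Qed.

Lemma gramwD u w : gramw X (u + w) = gramw X u + gramw X w.
Proof.
apply/matrixP => i j; rewrite [RHS]mxE !gramwE -big_split; apply: eq_bigr => k _ /=.
by rewrite mxE mulrDl.
Qed.

Lemma gramwZ c w : gramw X (c *: w) = c *: gramw X w.
Proof.
apply/matrixP => i j; rewrite [RHS]mxE !gramwE mulr_sumr; apply: eq_bigr => k _ /=.
by rewrite mxE -mulrA.
Qed.

Lemma quad_gramw w v : quad (gramw X w) v = \sum_i w i 0 * (X *m v) i 0 ^+ 2.
Proof.
have -> : quad (gramw X w) v = quad (diagc w) (X *m v).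
  by rewrite /quad /gramw trmx_mul !mulmxA.
rewrite /quad -mulmxA mul_diag_mx mxE; apply: eq_bigr => i _.
by rewrite !mxE mulrCA expr2.
Qed.

Lemma trace_mul_gramw (M : 'M[R]_n) w :
  \tr (M *m gramw X w) = \sum_i w i 0 * quad M (row i X)^T.
Proof.
rewrite /gramw !mulmxA mxtrace_mulC mulmxA /mxtrace.
apply: eq_bigr => i _; rewrite mulmxA mul_mx_diag mxE mulrC mxE; congr (_ * _).
rewrite /quad trmxK -row_mul [in RHS]mxE [LHS]mxE.
by apply: eq_bigr => j _; rewrite !mxE.
Qed.

Lemma trace_gramw w : \tr (gramw X w) = \sum_i w i 0 * rowsq X i.
Proof.
rewrite -[gramw X w]mul1mx trace_mul_gramw; apply: eq_bigr => i _.
by rewrite quad_scalar mul1r rowsq_norm2.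
Qed.

Lemma wnorm_ge0 w : 0 <= wnorm X w.
Proof. by apply: sumr_ge0 => i _; rewrite mulr_ge0 ?rowsq_ge0. Qed.

(** The trace is the [w]-weighted sum of the quadratic form of [M] at the rows
    of [X], so that the bound carries no factor [n]. *)
Lemma opbound_trace_gramw (M : 'M[R]_n) c w : opbound M c ->
  `|\tr (M *m gramw X w)| <= c * wnorm X w.
Proof.
move=> Mc; rewrite trace_mul_gramw mulr_sumr.
apply: le_trans (ler_norm_sum _ _ _) _; apply: ler_sum => i _.
rewrite normrM mulrCA ler_wpM2l ?normr_ge0 // rowsq_norm2.
exact: opbound_quad.
Qed.

Lemma quad_gramw_le w v : `|quad (gramw X w) v| <= wnorm X w * norm2 v ^+ 2.
Proof.
rewrite quad_gramw mulr_suml.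
apply: le_trans (ler_norm_sum _ _ _) _; apply: ler_sum => i _.
rewrite normrM -mulrA ler_wpM2l ?normr_ge0 // normrX real_normK ?num_real //.
by rewrite mxE norm2_sqr; apply: cauchy_schwarz.
Qed.

End Norms.

(** * Perturbation of the trace and of the log-determinant *)

(** The tangent-plane inequality used in both directions; the inverses of [M]
    and [N] are both bounded by [m^-1]. *)
Lemma ln_det_perturbation (R : realType) d (M N : 'M[R]_d) m t :
  M^T = M -> N^T = N -> 0 < m ->
  (forall v, m * norm2 v ^+ 2 <= quad M v) ->
  (forall v, m * norm2 v ^+ 2 <= quad N v) ->
  (forall W, opbound W m^-1 -> `|\tr (W *m (N - M))| <= t) ->
  `|ln (\det N) - ln (\det M)| <= t.
Proof.
move=> Ms Ns m0 Mm Nm bound.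
have := ln_det_sub_le Ms Ns m0 Mm m0 Nm.
have := ln_det_sub_le Ns Ms m0 Nm m0 Mm.
have := bound _ (coercive_opbound_inv m0 Mm).
have := bound _ (coercive_opbound_inv m0 Nm).
rewrite -[M - N]opprB mulmxN linearN /= !ler_norml.
move=> /andP[a1 a2] /andP[b1 b2] c1 c2.
lra.
Qed.

(** The deterministic comparison of [A^-1 B] with its estimate. The scale [s]
    plays the role of the sample size, [l] bounds the error on [A / s], and
    [t] is the common size of the three perturbations. Since the operators
    that multiply the perturbations are only known to be bounded, [D] is
    measured by [sqrt d] times its Frobenius norm and the Gram part by
    [wnorm]. *)
Lemma sandwich_perturbation (R : realType) p d (X : 'M[R]_(p, d))
    (A Ah B Bh D : 'M[R]_d) (w : 'cV[R]_p) (s a b K l t : R) :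
  A^T = A -> Ah^T = Ah -> B^T = B -> Bh^T = Bh ->
  0 < s -> 0 < a -> 0 < b -> 0 <= K -> 0 <= l -> 0 <= t -> t <= b / 4 ->
  (forall v, s * a * norm2 v ^+ 2 <= quad A v) ->
  (forall v, s * a * norm2 v ^+ 2 <= quad Ah v) ->
  (forall v, s * b * norm2 v ^+ 2 <= quad B v) ->
  opbound B (s * K) -> opbound (Ah - A) (s * l) -> d%:R * l <= t ->
  Bh = B + D + gramw X w -> d%:R * frob2 D <= (s * t) ^+ 2 ->
  wnorm X w <= s * t ->
  let C := 3 / a + K / a ^+ 2 + 4 / b in
  [/\ 0 < \det (invmx A *m B), 0 < \det (invmx Ah *m Bh),
    `|\tr (invmx Ah *m Bh) - \tr (invmx A *m B)| <= C * t &
    `|ln (\det (invmx Ah *m Bh)) - ln (\det (invmx A *m B))| <= C * t].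
Proof.
move=> As Ahs Bs Bhs s0 a0 b0 K0 l0 t0 tb Aa Aha Bb BK Al dl BhE Dt wt C.
have sa0 : 0 < s * a by rewrite mulr_gt0.
have sb0 : 0 < s * b by rewrite mulr_gt0.
have sb20 : 0 < s * (b / 2) by rewrite mulr_gt0 ?divr_gt0.
have st0 : 0 <= s * t by rewrite mulr_ge0 // ltW.
have Bhb v : s * (b / 2) * norm2 v ^+ 2 <= quad Bh v.
  rewrite BhE !quadD.
  have q1 : `|quad D v| <= s * t * norm2 v ^+ 2.
    apply: (@le_trans _ _ (Num.sqrt (frob2 D) * norm2 v ^+ 2)).
      exact/opbound_quad/opbound_sqrt_frob2.
    rewrite ler_wpM2r ?sqr_ge0 // -ler_sqr ?nnegrE ?sqrtr_ge0 //.
    by rewrite (sqr_sqrtr (frob2_ge0 D)); apply: le_trans Dt; apply: frob2_le_dim.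
  have q2 : `|quad (gramw X w) v| <= s * t * norm2 v ^+ 2.
    apply: le_trans (quad_gramw_le _ _ _) _.
    by rewrite ler_wpM2r ?sqr_ge0.
  move: q1 q2 (Bb v); rewrite !ler_norml => /andP[q1 _] /andP[q2 _] q3.
  have : s * t * norm2 v ^+ 2 <= s * (b / 4) * norm2 v ^+ 2.
    by rewrite ler_wpM2r ?sqr_ge0 // ler_wpM2l // ltW.
  lra.
have BhB W c : 0 < c -> opbound W (s * c)^-1 -> `|\tr (W *m (Bh - B))| <= 2 / c * t.
  move=> c0 Wc; have sc0 : 0 <= (s * c)^-1 by rewrite invr_ge0 mulr_ge0 // ltW.
  have -> : Bh - B = D + gramw X w by rewrite BhE -(addrA B D) addrAC subrr add0r.
  rewrite mulmxDr linearD /=.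
  apply: le_trans (ler_normD _ _) _.
  apply: le_trans (lerD (opbound_trace_mul sc0 st0 Wc Dt) (opbound_trace_gramw _ _ Wc)) _.
  apply: (@le_trans _ _ ((s * c)^-1 * (s * t) + (s * c)^-1 * (s * t))).
    by rewrite lerD2l ler_wpM2l.
  suff -> : (s * c)^-1 * (s * t) = c^-1 * t by lra.
  by rewrite invfM mulrACA mulVf ?mul1r // gt_eqF.
have AhA W : opbound W (s * a)^-1 -> `|\tr (W *m (Ah - A))| <= a^-1 * t.
  move=> Wc; have sc0 : 0 <= (s * a)^-1 by rewrite invr_ge0 ltW.
  apply: le_trans (opbound_trace (opboundM sc0 Wc Al)) _.
  have -> : (s * a)^-1 * (s * l) = a^-1 * l.
    by rewrite invfM mulrACA mulVf ?mul1r // gt_eqF.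
  by rewrite mulrCA ler_wpM2l // invr_ge0 ltW.
have Au := coercive_unitmx sa0 Aa; have Ahu := coercive_unitmx sa0 Aha.
have detA := coercive_det_gt0 As sa0 Aa.
have detAh := coercive_det_gt0 Ahs sa0 Aha.
have detB := coercive_det_gt0 Bs sb0 Bb.
have detBh := coercive_det_gt0 Bhs sb20 Bhb.
have Ca : 0 <= a^-1 * t by rewrite mulr_ge0 // invr_ge0 ltW.
have Cb : 0 <= b^-1 * t by rewrite mulr_ge0 // invr_ge0 ltW.
have CK : 0 <= K / a ^+ 2 * t by rewrite mulr_ge0 // divr_ge0 // exprn_ge0 // ltW.
split.
- by rewrite det_mulmx det_inv mulr_gt0 // invr_gt0.
- by rewrite det_mulmx det_inv mulr_gt0 // invr_gt0.
- have -> : \tr (invmx Ah *m Bh) - \tr (invmx A *m B) =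
     \tr (invmx Ah *m (Bh - B)) - \tr (invmx Ah *m (Ah - A) *m (invmx A *m B)).
    have -> : invmx Ah *m (Ah - A) *m (invmx A *m B)
        = invmx A *m B - invmx Ah *m B.
      by rewrite mulmxBr mulVmx // mulmxBl mul1mx -[invmx Ah *m A *m _]mulmxA mulKVmx.
    have trB (U V : 'M[R]_d) : \tr (U - V) = \tr U - \tr V by apply: linearB.
    by rewrite mulmxBr !trB; ring.
  have t1 := BhB _ a a0 (coercive_opbound_inv sa0 Aha).
  have t2 : `|\tr (invmx Ah *m (Ah - A) *m (invmx A *m B))| <= K / a ^+ 2 * t.
    have sc0 : 0 <= (s * a)^-1 by rewrite invr_ge0 ltW.
    have sl0 : 0 <= s * l by rewrite mulr_ge0 // ltW.
    have o1 := opboundM sc0 (coercive_opbound_inv sa0 Aha) Al.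
    have o2 := opboundM sc0 (coercive_opbound_inv sa0 Aa) BK.
    apply: le_trans (opbound_trace (opboundM (mulr_ge0 sc0 sl0) o1 o2)) _.
    have -> : (s * a)^-1 * (s * l) * ((s * a)^-1 * (s * K)) = K / a ^+ 2 * l.
      by field; rewrite !gt_eqF.
    by rewrite mulrCA ler_wpM2l // divr_ge0 // exprn_ge0 // ltW.
  apply: le_trans (ler_normB _ _) _; apply: le_trans (lerD t1 t2) _.
  rewrite /C; lra.
- rewrite !det_mulmx !det_inv !lnM ?posrE ?invr_gt0 // !lnV ?posrE //.
  have t1 := ln_det_perturbation As Ahs sa0 Aa Aha AhA.
  have Bb2 v : s * (b / 2) * norm2 v ^+ 2 <= quad B v.
    apply: le_trans (Bb v); rewrite ler_wpM2r ?sqr_ge0 // ler_wpM2l ?ltW //.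
    lra.
  have b20 : 0 < b / 2 by lra.
  have t2 := ln_det_perturbation Bs Bhs sb20 Bb2 Bhb (fun W => BhB W _ b20).
  have -> : forall x y z u : R, - x + y - (- z + u) = (y - u) - (x - z) by move=> *; ring.
  apply: le_trans (ler_normB _ _) _; apply: le_trans (lerD t2 t1) _.
  have -> : 2 / (b / 2) * t = 4 * (b^-1 * t) by field; rewrite gt_eqF.
  rewrite /C; lra.
Qed.

(** * Real-valued expectations *)

Section Integration.
Context {R : realType} {disp : measure_display} {T : measurableType disp}.
Variable P : probability T R.
Implicit Types f g : T -> R.

Definition L1 (f : T -> R) : Prop := P.-integrable setT (EFin \o f).
Definition mean (f : T -> R) : R := \int[P]_w f w.

Lemma L1_measurable f : L1 f -> measurable_fun setT f.
Proof. by move=> /measurable_int /measurable_EFinP. Qed.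

Lemma L1_le (f g : T -> R) : measurable_fun setT f -> (forall w, `|f w| <= g w) ->
  L1 g -> L1 f.
Proof.
move=> mf fg ig; apply: le_integrable ig => //; first exact/measurable_EFinP.
move=> w _ /=; rewrite lee_fin; apply: le_trans (fg w) _; exact: ler_norm.
Qed.

Lemma L1_cst (c : R) : L1 (fun=> c).
Proof. exact: finite_measure_integrable_cst. Qed.

Lemma L1D f g : L1 f -> L1 g -> L1 (fun w => f w + g w).
Proof.
move=> fi gi; have := integrableD measurableT fi gi.
exact.
Qed.

Lemma L1Z c f : L1 f -> L1 (fun w => c * f w).
Proof. by move=> fi; have := integrableZl measurableT c fi. Qed.

Lemma L1_sum n (f : 'I_n -> T -> R) : (forall i, L1 (f i)) ->
  L1 (fun w => \sum_i f i w).
Proof.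
move=> fi; rewrite /L1.
have -> : EFin \o (fun w => \sum_i f i w) = (fun w => \sum_i (f i w)%:E)%E.
  by apply/funext => w /=; rewrite sumEFin.
by apply: integrable_sum => // i _; apply: fi.
Qed.

Lemma L1B f g : L1 f -> L1 g -> L1 (fun w => f w - g w).
Proof.
move=> fi gi; have := L1D fi (L1Z (-1) gi).
by congr L1; apply/funext => w; rewrite mulN1r.
Qed.

Lemma L1_mul f g : measurable_fun setT f -> measurable_fun setT g ->
  L1 (fun w => f w ^+ 2) -> L1 (fun w => g w ^+ 2) -> L1 (fun w => f w * g w).
Proof.
move=> mf mg fi gi; apply: L1_le (L1D fi gi); first exact: measurable_funM.
move=> w; rewrite normrM.
have := sqr_ge0 (`|f w| - `|g w|); have := sqr_ge0 (`|f w| + `|g w|).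
rewrite sqrrB sqrrD !real_normK ?num_real // => h1 h2.
have : 0 <= `|f w| * `|g w| by rewrite mulr_ge0.
lra.
Qed.

Lemma L1_of_sqr f : measurable_fun setT f -> L1 (fun w => f w ^+ 2) -> L1 f.
Proof.
move=> mf fi; have := @L1_mul f (fun=> 1) mf (measurable_cst _) fi.
rewrite expr1n => /(_ (L1_cst 1)).
by congr L1; apply/funext => w; rewrite mulr1.
Qed.

Lemma meanD f g : L1 f -> L1 g -> mean (fun w => f w + g w) = mean f + mean g.
Proof. exact: RintegralD. Qed.

Lemma meanB f g : L1 f -> L1 g -> mean (fun w => f w - g w) = mean f - mean g.
Proof. exact: RintegralB. Qed.

Lemma meanZ c f : L1 f -> mean (fun w => c * f w) = c * mean f.
Proof. exact: RintegralZl. Qed.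

Lemma mean_cst c : mean (fun=> c) = c.
Proof.
rewrite /mean Rintegral_cst //; transitivity (c * fine (1%E : \bar R)).
  by congr (_ * fine _); apply: probability_setT.
by rewrite mulr1.
Qed.

Lemma mean_le f g : L1 f -> L1 g -> (forall w, f w <= g w) -> mean f <= mean g.
Proof. by move=> fi gi fg; apply: le_Rintegral. Qed.

Lemma mean_ge0 f : (forall w, 0 <= f w) -> 0 <= mean f.
Proof. by move=> f0; apply: Rintegral_ge0. Qed.

Lemma mean_sum n (f : 'I_n -> T -> R) : (forall i, L1 (f i)) ->
  mean (fun w => \sum_i f i w) = \sum_i mean (f i).
Proof.
elim: n f => [|n IH] f fi.
  rewrite big_ord0 -[RHS](mean_cst 0); congr mean.
  by apply/funext => w; rewrite big_ord0.
rewrite big_ord_recl -IH; last by move=> i; apply: fi.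
rewrite -meanD //; last by apply: L1_sum => i; apply: fi.
by congr mean; apply/funext => w; rewrite big_ord_recl.
Qed.

Lemma L1_mean f : L1 f -> (\int[P]_w (f w)%:E)%E = (mean f)%:E.
Proof. by move=> fi; rewrite /mean /Rintegral fineK // integrable_fin_num. Qed.

Lemma markov_ge0 f t : L1 f -> (forall w, 0 <= f w) -> 0 < t ->
  (P [set w | (t < f w)%R] <= (mean f / t)%:E)%E.
Proof.
move=> fi f0 t0; have mf := L1_measurable fi.
have mA : measurable [set w | (t < f w)%R].
  rewrite -[X in measurable X]setTI.
  rewrite (_ : [set w | _] = f @^-1` `]t, +oo[%classic).
    exact: mf.
  by apply/seteqP; split => w /=; rewrite in_itv /= andbT.
set A := [set w | _] in mA *.
have iA : L1 (\1_A) by apply: integrable_indic.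
have PA : P A = (mean (\1_A))%:E.
  rewrite -L1_mean // integral_indic // setIT //.
rewrite PA lee_fin ler_pdivlMr // mulrC -meanZ //.
apply: mean_le => //; first exact: L1Z.
move=> w; rewrite indicE; case: (boolP (w \in A)) => [|_]; last by rewrite mulr0.
by rewrite inE /A /= mulr1 => /ltW.
Qed.

End Integration.

(** * Independence and moments *)

Section Independence.
Context {R : realType} {disp : measure_display} {T : measurableType disp}.
Variable P : probability T R.

Section Product.
Variables (U V : T -> R).
Hypotheses (mU : measurable_fun setT U) (mV : measurable_fun setT V).

Let Z w : R * R := (U w, V w).
Let mZ : measurable_fun setT Z.
Proof. exact: measurable_fun_pair. Qed.

HB.instance Definition _ := isMeasurableFun.Build _ _ _ _ U mU.
HB.instance Definition _ := isMeasurableFun.Build _ _ _ _ V mV.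
HB.instance Definition _ := isMeasurableFun.Build _ _ _ _ Z mZ.

Let lawU : probability R R := distribution P U.
Let lawV : probability R R := distribution P V.
Let lawZ : probability (R * R)%type R := distribution P Z.

(** The joint law agrees with the product of the laws on rectangles, hence
    everywhere, and Fubini's theorem applies to the product [x * y]. *)
Lemma indep_mean_mul :
  (forall A B, measurable A -> measurable B ->
     P (U @^-1` A `&` V @^-1` B) = (P (U @^-1` A) * P (V @^-1` B))%E) ->
  L1 P U -> L1 P V ->
  L1 P (fun w => U w * V w) /\ mean P (fun w => U w * V w) = mean P U * mean P V.
Proof.
move=> ind iU iV.
have lawE X : measurable X -> (lawU \x lawV)%E X = lawZ X.
  by apply: product_measure_unique => A B mA mB; rewrite -[RHS]ind.
pose h (p : R * R) : \bar R := (p.1 * p.2)%:E.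
have mh : measurable_fun setT h.
  by apply/measurable_EFinP; apply: measurable_funM.
have UE : (\int[lawU]_x x%:E)%E = (mean P U)%:E.
  by rewrite -L1_mean // [LHS]integral_distribution.
have VE : (\int[lawV]_x x%:E)%E = (mean P V)%:E.
  by rewrite -L1_mean // [LHS]integral_distribution.
have absE (W : {mfun T >-> R}) : (\int[distribution P W]_x `|x%:E|)%E
    = (\int[P]_w `|(W w)%:E|)%E.
  rewrite ge0_integral_distribution //.
  by apply: measurableT_comp => //; apply/measurable_EFinP.
have hint : (lawU \x lawV)%E.-integrable setT h.
  apply/(integrable12ltyP _ _ mh).
  have inner x : (\int[lawV]_y `|h (x, y)| = `|x%:E| * \int[lawV]_y `|y%:E|)%E.
    rewrite -ge0_integralZl //; last first.
      by apply: measurableT_comp => //; apply/measurable_EFinP.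
    by apply: eq_integral => y _; rewrite /h /= normrM EFinM.
  under eq_integral do rewrite inner.
  rewrite ge0_integralZr //; last 2 first.
  - by apply: measurableT_comp => //; apply/measurable_EFinP.
  - by apply: integral_ge0.
  rewrite /lawU /lawV !absE.
  have /integrableP [_ Ufin] := iU; have /integrableP [_ Vfin] := iV.
  by apply: lte_mul_pinfty => //; [apply: integral_ge0|rewrite ge0_fin_numE ?integral_ge0].
have hP : P.-integrable setT (h \o Z).
  apply/integrableP; split; first by apply: measurableT_comp.
  have <- : (\int[lawZ]_z `|h z| = \int[P]_w `|(h \o Z) w|)%E.
    by rewrite /lawZ ge0_integral_distribution //; apply: measurableT_comp.
  rewrite -(@eq_measure_integral _ _ _ setT lawZ (lawU \x lawV)%E).
    by case/integrableP : hint.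
  by move=> A mA _; apply: lawE.
split; first exact: hP.
apply: EFin_inj; rewrite -L1_mean //.
rewrite -[LHS]/(\int[P]_w (h \o Z) w)%E -integral_distribution // -/lawZ.
rewrite -(@eq_measure_integral _ _ _ setT lawZ (lawU \x lawV)%E); last first.
  by move=> A mA _; apply: lawE.
rewrite -integral12_prod_meas1 //.
have idint (W : {mfun T >-> R}) : L1 P W ->
    (distribution P W).-integrable setT (EFin : R -> \bar R).
  move=> /integrableP [_ Wfin]; apply/integrableP; split.
    exact/measurable_EFinP.
  by rewrite absE.
have inner x : (\int[lawV]_y h (x, y) = (mean P V)%:E * x%:E)%E.
  by rewrite muleC -VE -integralZl //; apply: idint.

rewrite (eq_integral (fun x : R => (mean P V)%:E * x%:E)%E); last first.
  by move=> x _; apply: inner.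
by rewrite integralZl // ?UE -?EFinM 1?mulrC //; apply: idint.
Qed.
End Product.

Lemma independent_mean_mul n (Y : 'I_n -> {RV P >-> R}) i k (f g : R -> R) :
  independent_family Y -> i != k ->
  measurable_fun setT f -> measurable_fun setT g ->
  L1 P (f \o Y i) -> L1 P (g \o Y k) ->
  mean P (fun w => f (Y i w) * g (Y k w)) = mean P (f \o Y i) * mean P (g \o Y k).
Proof.
move=> ind ik mf mg fi gk.
apply: (proj2 (indep_mean_mul (U := f \o Y i) (V := g \o Y k) _ _ _ fi gk)).
- exact: measurableT_comp.
- exact: measurableT_comp.
move=> A B mA mB.
have mfA : measurable (f @^-1` A) by rewrite -[X in measurable X]setTI; apply: mf.
have mgB : measurable (g @^-1` B) by rewrite -[X in measurable X]setTI; apply: mg.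
(* Independence is stated for the whole family: the other coordinates are
   left unconstrained. *)
pose E j := if j == i then f @^-1` A else if j == k then g @^-1` B else setT.
have mE j : measurable (E j) by rewrite /E; case: ifP => // _; case: ifP.
have Ei : E i = f @^-1` A by rewrite /E eqxx.
have Ek : E k = g @^-1` B by rewrite /E eq_sym (negPf ik) eqxx.
have := ind E mE.
rewrite (bigD1 i) //= (bigD1 k) /=; last by rewrite eq_sym.
rewrite big1 ?mule1; last first.
  move=> j /andP[ji jk]; rewrite /E (negPf ji) (negPf jk) preimage_setT.
  exact: probability_setT.
rewrite Ei Ek => <-; congr (P _); apply/seteqP; split=> w /=.
  move=> [wA wB] j; rewrite /E; case: eqP => [->//|_].
  by case: eqP => [->//|_].
move=> wE; split; first by have := wE i; rewrite Ei.
by have := wE k; rewrite Ek.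
Qed.

Lemma orthogonal_sum_sqr n (Z : 'I_n -> T -> R) (c : 'I_n -> R) :
  (forall i, measurable_fun setT (Z i)) ->
  (forall i, L1 P (fun w => Z i w ^+ 2)) ->
  (forall i k, i != k -> mean P (fun w => Z i w * Z k w) = 0) ->
  L1 P (fun w => (\sum_i c i * Z i w) ^+ 2) /\
  mean P (fun w => (\sum_i c i * Z i w) ^+ 2)
    = \sum_i c i ^+ 2 * mean P (fun w => Z i w ^+ 2).
Proof.
move=> mZ Z2 orth.
have E : (fun w => (\sum_i c i * Z i w) ^+ 2)
    = (fun w => \sum_i \sum_k (c i * c k) * (Z i w * Z k w)).
  apply/funext => w; rewrite expr2 mulr_suml; apply: eq_bigr => i _.
  by rewrite mulr_sumr; apply: eq_bigr => k _; rewrite mulrACA.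
have i2 i k : L1 P (fun w => (c i * c k) * (Z i w * Z k w)).
  by apply/L1Z/L1_mul.
have i1 i : L1 P (fun w => \sum_k (c i * c k) * (Z i w * Z k w)).
  exact: L1_sum.
rewrite E; split; first exact: L1_sum.
rewrite mean_sum //; apply: eq_bigr => i _; rewrite mean_sum //.
rewrite (bigD1 i) //= big1 ?addr0.
  rewrite meanZ -?expr2; first by congr (_ * mean P _).
  by have := L1_mul (mZ i) (mZ i) (Z2 i) (Z2 i).
move=> k ki; rewrite meanZ; first by rewrite orth ?mulr0 // eq_sym.
exact: L1_mul.
Qed.

(** The tail of the exponential at [r > 1] is at most [H / r^2], since [2 H ln
    r] is the value of [q^2] at which it reaches [r]. Comparing with the
    Cauchy density, whose integral is known, gives the constant [pi]. *)
Lemma subgaussian_exp_moment (q : T -> R) (H : R) : 0 < H ->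
  measurable_fun setT q ->
  (forall t : R, 0 <= t ->
    (P [set w | (t < `|q w|)%R] <= (H * expR (- t ^+ 2 / H))%:E)%E) ->
  L1 P (fun w => expR (q w ^+ 2 / (2 * H))) /\
  mean P (fun w => expR (q w ^+ 2 / (2 * H))) <= (1 + H) * pi.
Proof.
move=> H0 mq tail.
pose X w := expR (q w ^+ 2 / (2 * H)).
have mX : measurable_fun setT X.
  apply: measurableT_comp => //; apply: measurable_funM => //.
  exact: measurable_funX.
pose XR := mfun_Sub (mem_set mX) : {RV P >-> R}.
have X1 w : 1 <= X w.
  by rewrite /X -expR0 ler_expR divr_ge0 ?sqr_ge0 // mulr_ge0 // ltW.
have X0 w : 0 <= X w by apply: le_trans (X1 w).
have bound r : 0 <= r -> (ccdf XR r <= (2 * (1 + H) * (oneDsqr r)^-1)%:E)%E.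
  move=> r0; have rp : 0 < oneDsqr r by rewrite /oneDsqr ltr_wpDr ?sqr_ge0.
  have [r1|r1] := leP r 1.
    apply: le_trans (probability_le1 _ _) _ => //.
    rewrite lee_fin ler_pdivlMr // mul1r /oneDsqr.
    nra.
  have lr : 0 < ln r by rewrite ln_gt0.
  (* The value of |q| at which the exponential equals r. *)
  pose t := Num.sqrt (2 * H * ln r).
  have t0 : 0 <= t by apply: sqrtr_ge0.
  have t2 : t ^+ 2 = 2 * H * ln r by rewrite sqr_sqrtr // !mulr_ge0 // ltW.
  have -> : ccdf XR r = P [set w | (t < `|q w|)%R].
    rewrite /ccdf /distribution /pushforward /=; congr (P _).
    apply/seteqP; split => w /=.
      rewrite in_itv /= andbT /X => rX.
      rewrite -ltr_sqr ?nnegrE ?normr_ge0 // real_normK ?num_real // t2.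
      rewrite mulrC -ltr_pdivlMr ?mulr_gt0 //.
      by rewrite -ltr_expR lnK // posrE (lt_trans _ r1).
    rewrite in_itv /= andbT /X.
    rewrite -ltr_sqr ?nnegrE ?normr_ge0 // real_normK ?num_real // t2.
    rewrite mulrC -ltr_pdivlMr ?mulr_gt0 //.
    by rewrite -ltr_expR lnK // posrE (lt_trans _ r1).
  apply: le_trans (tail t t0) _; rewrite lee_fin t2.
  have -> : - (2 * H * ln r) / H = - (ln r + ln r) by field; rewrite gt_eqF.
  rewrite expRN expRD lnK ?posrE ?(lt_trans _ r1) //.
  rewrite ler_pdivrMr ?mulr_gt0 ?(lt_trans _ r1) //.
  rewrite mulrAC ler_pdivlMr // /oneDsqr.
  have r2 : 1 <= r * r by nra.
  have : H * (1 + r ^+ 2) <= H * (2 * (r * r)) by rewrite ler_wpM2l ?ltW //; nra.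
  nra.
have EX : ('E_P[XR] <= ((1 + H) * pi)%:E)%E.
  rewrite ge0_expectation_ccdf //.
  have C0 : 0 <= 2 * (1 + H) by lra.
  have -> : ((1 + H) * pi)%:E = (\int[lebesgue_measure]_(r in `[0%R, +oo[)
      ((2 * (1 + H))%:E * ((oneDsqr r)^-1)%:E))%E.
    rewrite ge0_integralZl_EFin //.
    - rewrite integral0y_oneDsqr -EFinM; congr EFin; field.
    - by [].
    - apply: measurable_funTS; apply/measurable_EFinP.
      by apply: continuous_measurable_fun; apply: continuous_oneDsqrV.
  apply: ge0_le_integral => //.
  - by apply: measurable_funTS; apply: ccdf_measurable.
  - apply: measurable_funTS; apply/measurable_EFinP; apply: measurable_funM => //.
    by apply: continuous_measurable_fun; apply: continuous_oneDsqrV.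
  - by move=> r /=; rewrite in_itv /= andbT => r0; rewrite -EFinM; apply: bound.
have iX : L1 P X.
  apply/integrableP; split; first exact/measurable_EFinP.
  apply: le_lt_trans (ltry ((1 + H) * pi)).
  move: EX; rewrite expectation_def; apply: le_trans.
  rewrite le_eqVlt; apply/orP; left; apply/eqP.
  by apply: eq_integral => w _ /=; rewrite ger0_norm.
split=> //; rewrite -lee_fin -L1_mean //.
by move: EX; rewrite expectation_def.
Qed.

End Independence.

(** * The Kullback-Leibler minimizer as a maximizer of the mean log-likelihood *)

Section MeanLoglik.
Context {R : realType} {disp : measure_display} {T : measurableType disp}.
Variable P : probability T R.

(** With the convention [+oo - oo = -oo], a finite integral forces the
    integrals of the positive and negative parts to be finite. *)
Lemma fin_num_integrable (f : T -> \bar R) : measurable_fun setT f ->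
  (\int[P]_w f w)%E \is a fin_num -> P.-integrable setT f.
Proof.
move=> mf; rewrite integralE => ffin; apply/integrableP; split=> //.
have p0 : (0 <= \int[P]_w f^\+ w)%E by apply: integral_ge0.
have n0 : (0 <= \int[P]_w f^\- w)%E by apply: integral_ge0.
have -> : (fun w => `|f w|%E) = (f^\+ \+ f^\-)%E by rewrite -fune_abse.
rewrite ge0_integralD //; last 2 first.
- exact: measurable_funepos.
- exact: measurable_funeneg.
move: ffin p0 n0.
case: (\int[P]_w f^\+ w)%E => [x| |] //; case: (\int[P]_w f^\- w)%E => [y| |] //.
by move=> _ _ _; rewrite -EFinD ltry.
Qed.

Variables (n d : nat) (Y : 'I_n -> {RV P >-> R}).

Lemma meanvE i : meanv Y i 0 = mean P (Y i).
Proof. by rewrite mxE expectation_def. Qed.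

Lemma loglikE b (X : 'M[R]_(n, d)) y beta :
  loglik b X y beta
    = \sum_i (y i 0 * (X *m beta) i 0 - b ((X *m beta) i 0)).
Proof.
rewrite /loglik -mulmxA mxE sumrB; congr (_ - _).
by apply: eq_bigr => i _; rewrite mxE.
Qed.

(** The set where a density vanishes has probability the integral of zero. *)
Lemma density_gt0_ae (nu : 'I_n -> {sigma_finite_measure set R -> \bar R})
    (g : 'I_n -> R -> R) : (forall i, has_density (nu i) (Y i) (g i)) ->
  {ae P, forall w, 0 < product_density g (rvec Y w)}.
Proof.
move=> dens.
have gi i : {ae P, forall w, 0 < g i (Y i w)}.
  have [mg g0 PE] := dens i.
  have mE : measurable (g i @^-1` [set 0]).
    by rewrite -[X in measurable X]setTI; apply: mg.
  exists (Y i @^-1` (g i @^-1` [set 0])); split.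
  - by rewrite -[X in measurable X]setTI; apply: measurable_funP.
  - rewrite PE // integral0_eq // => y /= ->.
    by [].
  - move=> w /= /negP; rewrite -leNgt => gw.
    by apply/eqP; rewrite eq_le gw g0.
have : {ae P, forall w, forall i, 0 < g i (Y i w)} by apply: filter_forall.
apply: filterS => w gw.
by apply: prodr_gt0 => i _; rewrite mxE gw.
Qed.

(** Where the true density is positive, the integrand at [beta] is the one at
    [beta0] plus the difference of two log-likelihoods, which is affine in [Y]
    and thus integrates to its value at the mean. Finiteness of the divergence
    at [beta0] allows the two integrals to be separated. *)
Lemma KL_minimizer_loglik (b : R -> R) (X : 'M[R]_(n, d))
    (nu : 'I_n -> {sigma_finite_measure set R -> \bar R})
    (g : 'I_n -> R -> R) (kappa : 'I_n -> R) beta0 :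
  (forall i, has_density (nu i) (Y i) (g i)) ->
  (forall i, L1 P (Y i)) -> (forall i, 0 < kappa i) ->
  is_KL_minimizer Y b X kappa g beta0 -> is_QMLE b X (meanv Y) beta0.
Proof.
move=> dens iY k0 [fin minb] beta.
pose F be w := ln (product_density g (rvec Y w) /
                   working_density b X kappa (rvec Y w) be).
have KLE be : KL Y b X kappa g be = (\int[P]_w (F be w)%:E)%E.
  by rewrite /KL unlock.
have mll be : measurable_fun setT (fun w => loglik b X (rvec Y w) be).
  rewrite (_ : (fun w => _) = fun w => \sum_i (Y i w * (X *m be) i 0 - b ((X *m be) i 0))).
    apply: measurable_sum => i; apply: measurable_funB => //.
    exact: measurable_funM.
  apply/funext => w; rewrite loglikE.
  by apply: eq_bigr => i _; rewrite [rvec _ _ _ _]mxE.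
have mF be : measurable_fun setT (F be).
  apply: measurableT_comp; first exact: measurable_ln.
  rewrite (_ : (fun w => _) = fun w => (\prod_i g i (Y i w)) *
      (expR (- loglik b X (rvec Y w) be) * \prod_i kappa i)).
    apply: measurable_funM.
      apply: measurable_prod => i _; apply: measurableT_comp => //.
      by have [] := dens i.
    apply: measurable_funM => //; apply: measurableT_comp => //.
    exact: measurable_funN.
  apply/funext => w; rewrite /product_density /working_density invfM invrK expRN.
  by congr (_ * _); apply: eq_bigr => i _; rewrite mxE.
have F0 : L1 P (F beta0).
  apply: fin_num_integrable; first exact/measurable_EFinP.
  by rewrite -KLE.
pose D w := loglik b X (rvec Y w) beta0 - loglik b X (rvec Y w) beta.
have iY2 be : L1 P (fun w => loglik b X (rvec Y w) be) /\
    mean P (fun w => loglik b X (rvec Y w) be) = loglik b X (meanv Y) be.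
  have E : (fun w => loglik b X (rvec Y w) be) =
     (fun w => \sum_i ((X *m be) i 0 * Y i w - b ((X *m be) i 0))).
    apply/funext => w; rewrite loglikE.
    by apply: eq_bigr => i _; rewrite [rvec _ _ _ _]mxE mulrC.
  have ii i : L1 P (fun w => (X *m be) i 0 * Y i w - b ((X *m be) i 0)).
    by apply: L1B; [apply: L1Z|apply: L1_cst].
  rewrite E; split; first exact: L1_sum.
  rewrite mean_sum // loglikE; apply: eq_bigr => i _.
  rewrite meanB; [|exact: L1Z|exact: L1_cst].
  by rewrite meanZ // mean_cst meanvE mulrC.
have [l0 m0] := iY2 beta0; have [l1 m1] := iY2 beta.
have iD : L1 P D by apply: L1B.
have Feq : (\int[P]_w (F beta w)%:E = \int[P]_w (F beta0 w + D w)%:E)%E.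
  apply: ae_eq_integral => //.
  - exact/measurable_EFinP.
  - by apply/measurable_EFinP; apply: measurable_funD => //; apply: L1_measurable iD.
  have := density_gt0_ae dens; apply: filterS => w gw _.
  have kp : 0 < \prod_i kappa i by apply: prodr_gt0.
  have lnF be : F be w = ln (product_density g (rvec Y w))
      - loglik b X (rvec Y w) be + ln (\prod_i kappa i).
    have wp : 0 < working_density b X kappa (rvec Y w) be.
      by rewrite divr_gt0 ?expR_gt0.
    rewrite /F ln_div ?posrE // ln_div ?posrE ?expR_gt0 // expRK.
    ring.
  by congr EFin; rewrite !lnF /D; ring.
have := minb beta; rewrite !KLE Feq (L1_mean F0) (L1_mean (L1D F0 iD)) lee_fin.
by rewrite meanD // meanB // m0 m1; lra.
Qed.

End MeanLoglik.

(** * The score along a line *)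

Section Concavity.
Context {R : realType}.
Variable b : R -> R.
Hypothesis b_cumulant : cumulant_function b.
Variables (n d : nat) (X : 'M[R]_(n, d)).
Implicit Types (y : 'cV[R]_n) (beta u v : 'cV[R]_d).

Lemma cumulant_derive (t : R) : is_derive t 1 b (derive1 b t).
Proof.
have [_ [db _] _ _] := b_cumulant.
by apply: DeriveDef => //; rewrite derive1E.
Qed.

Lemma cumulant_derive2 (t : R) :
  is_derive t 1 (derive1 b) (derive1n 2 b t).
Proof.
have [_ [_ db] _ _] := b_cumulant.
apply: DeriveDef; first exact: db.
by rewrite -derive1E derive1nS derive1n1.
Qed.

Lemma cumulant_curvature_ge0 (t : R) : 0 <= derive1n 2 b t.
Proof.
by have [_ _ _ [m m0 mb]] := b_cumulant; apply: le_trans (mb t); apply: ltW.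
Qed.

Lemma is_derive_affine (a h s : R) : is_derive s 1 (fun s => a + s * h) h.
Proof.
rewrite (_ : (fun s => _) = cst a + h \*: id).
  by apply: is_derive_eq; rewrite add0r; apply: mulr1.
by apply/funext => t; rewrite /= mulrC.
Qed.

Lemma mulmx_line beta u (s : R) i :
  (X *m (beta + s *: u)) i 0 = (X *m beta) i 0 + s * (X *m u) i 0.
Proof. by rewrite mulmxDr -scalemxAr [LHS]mxE [X in _ + X]mxE. Qed.

(** The derivative of the log-likelihood along the line through [beta] with
    direction [u], at [beta + s u]. *)
Definition score (y : 'cV[R]_n) (beta u : 'cV[R]_d) (s : R) : R :=
  \sum_i (y i 0 - derive1 b ((X *m beta) i 0 + s * (X *m u) i 0)) * (X *m u) i 0.

Lemma is_derive_loglik_line y beta u (s : R) :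
  is_derive s 1 (fun s => loglik b X y (beta + s *: u)) (score y beta u s).
Proof.
pose f i (s : R) := y i 0 * ((X *m beta) i 0 + s * (X *m u) i 0)
                    - b ((X *m beta) i 0 + s * (X *m u) i 0).
rewrite (_ : (fun s => _) = \sum_i f i).
  apply: is_derive_sum => i.
  have da := is_derive_affine ((X *m beta) i 0) ((X *m u) i 0) s.
  have db := cumulant_derive ((X *m beta) i 0 + s * (X *m u) i 0).
  have dc := is_derive1_comp (f := b)
    (g := fun s => (X *m beta) i 0 + s * (X *m u) i 0) db da.
  rewrite (_ : f i = (y i 0 \*: (fun s => (X *m beta) i 0 + s * (X *m u) i 0))
    - (b \o (fun s => (X *m beta) i 0 + s * (X *m u) i 0))) //.
  by apply: is_derive_eq; rewrite mulrBl.
apply/funext => t; rewrite loglikE fct_sumE; apply: eq_bigr => i _.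
by rewrite mulmx_line.
Qed.

Lemma is_derive_score y beta u (s : R) :
  is_derive s 1 (score y beta u) (- quad (glm_info b X (beta + s *: u)) u).
Proof.
pose f i (s : R) := (y i 0 - derive1 b ((X *m beta) i 0 + s * (X *m u) i 0))
                    * (X *m u) i 0.
have -> : - quad (glm_info b X (beta + s *: u)) u = \sum_i
   - (derive1n 2 b ((X *m beta) i 0 + s * (X *m u) i 0) * (X *m u) i 0 ^+ 2).
  rewrite sumrN [quad _ _]quad_gramw; congr (- _); apply: eq_bigr => i _.
  by rewrite [map_mx _ _ i 0]mxE mulmx_line.
rewrite (_ : score _ _ _ = \sum_i f i).
  apply: is_derive_sum => i.
  have da := is_derive_affine ((X *m beta) i 0) ((X *m u) i 0) s.
  have db := cumulant_derive2 ((X *m beta) i 0 + s * (X *m u) i 0).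
  have dc := is_derive1_comp (f := derive1 b)
    (g := fun s => (X *m beta) i 0 + s * (X *m u) i 0) db da.
  rewrite (_ : f i = (X *m u) i 0 \*: (cst (y i 0)
    - (derive1 b \o (fun s => (X *m beta) i 0 + s * (X *m u) i 0)))).
    by apply: is_derive_eq; rewrite sub0r /GRing.scale /=; ring.
  by apply/funext => t; rewrite /f /= mulrC.
by apply/funext => t; rewrite /score fct_sumE.
Qed.

Lemma quad_glm_info beta v : quad (glm_info b X beta) v
  = \sum_i derive1n 2 b ((X *m beta) i 0) * (X *m v) i 0 ^+ 2.
Proof.
by rewrite [quad _ _]quad_gramw; apply: eq_bigr => i _; rewrite [map_mx _ _ i 0]mxE.
Qed.

Lemma glm_info_ge0 beta v : 0 <= quad (glm_info b X beta) v.
Proof.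
rewrite quad_glm_info; apply: sumr_ge0 => i _.
by rewrite mulr_ge0 ?sqr_ge0 ?cumulant_curvature_ge0.
Qed.

Lemma QMLE_score_eq0 y beta u : is_QMLE b X y beta -> score y beta u 0 = 0.
Proof.
move=> opt; pose f s := loglik b X y (beta + s *: u).
have d0 : is_derive (0 : R) 1 f 0.
  apply: (@derive1_at_max _ f (-1) 1).
  - by lra.
  - by move=> t _; have [] := is_derive_loglik_line y beta u t.
  - by rewrite in_itv /=; apply/andP; split; lra.
  - by move=> t _; rewrite /f scale0r addr0; apply: opt.
have [_ <-] := is_derive_loglik_line y beta u 0.
by have [_ ->] := d0.
Qed.

Lemma QMLE_score_eq0_end y beta u : is_QMLE b X y (beta + u) -> score y beta u 1 = 0.
Proof.
move=> /(QMLE_score_eq0 u) <-; apply: eq_bigr => i _.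
by rewrite mul0r addr0 -mulmx_line scale1r.
Qed.

Lemma score_mvt y beta u (s t : R) : s < t ->
  exists2 c, s < c < t & score y beta u s - score y beta u t
     = (t - s) * quad (glm_info b X (beta + c *: u)) u.
Proof.
move=> st.
have cont : {within `[s, t], continuous (score y beta u)}.
  apply: continuous_subspaceT => x; apply: differentiable_continuous.
  by apply/derivable1_diffP; have [] := is_derive_score y beta u x.
have [c cst E] := MVT st (fun x _ => is_derive_score y beta u x) cont.
exists c; first by move: cst; rewrite in_itv.
by rewrite -opprB E mulNr opprK mulrC.
Qed.

(** The score along the segment from [beta] to [beta + u] decreases and
    vanishes at the far end, so it is nonnegative at [t]. Hence its value at
    [0], which is the inner product of [X^T (y - ybar)] with [u], is at least
    its decrease over [[0, t]], given by the mean value theorem. *)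
Lemma QMLE_score_bound ybar y beta u t :
  is_QMLE b X ybar beta -> is_QMLE b X y (beta + u) -> 0 < t <= 1 ->
  exists2 s, 0 < s < t &
    t * quad (glm_info b X (beta + s *: u)) u <= ((X^T *m (y - ybar))^T *m u) 0 0.
Proof.
move=> o0 o1 /andP[t0 t1].
have s1 := QMLE_score_eq0_end o1.
have st : 0 <= score y beta u t.
  move: t1; rewrite le_eqVlt => /orP[/eqP -> | t1]; first by rewrite s1.
  have [c _ E] := score_mvt y beta u t1.
  rewrite s1 subr0 in E; rewrite E mulr_ge0 ?glm_info_ge0 // subr_ge0 ltW //.
have [s s0t E] := score_mvt y beta u t0.
exists s => //; rewrite subr0 in E; rewrite -E.
have -> : ((X^T *m (y - ybar))^T *m u) 0 0 = score y beta u 0.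
  transitivity (score y beta u 0 - score ybar beta u 0); last first.
    by rewrite (QMLE_score_eq0 u o0) subr0.
  rewrite -sumrB.
  rewrite trmx_mul trmxK -mulmxA mxE; apply: eq_bigr => i _.
  by set h := (X *m u) i 0; set th := (X *m beta) i 0; rewrite !mxE; ring.
by rewrite gerBl.
Qed.

End Concavity.

(** * Moments of the errors *)

Section Noise.
Context {R : realType} {disp : measure_display} {T : measurableType disp}.
Variables (P : probability T R) (n d : nat) (Y : 'I_n -> {RV P >-> R}).
Variables (X : 'M[R]_(n, d)) (K H : R).
Hypothesis indY : independent_family Y.
Hypothesis sqrY : forall i, ('E_P[fun w => (Y i w ^+ 2)%R] <= K%:E)%E.
Hypothesis varY : forall i, (0 < 'V_P[Y i])%E.

Definition err (i : 'I_n) (w : T) : R := Y i w - meanv Y i 0.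
Definition varv : 'cV[R]_n := \col_i fine 'V_P[Y i].

Lemma sqr_expectation_L1 (f : T -> R) k : measurable_fun setT f ->
  ('E_P[fun w => (f w ^+ 2)%R] <= k%:E)%E ->
  L1 P (fun w => f w ^+ 2) /\ mean P (fun w => f w ^+ 2) <= k.
Proof.
move=> mf; rewrite unlock => fk.
have mf2 : measurable_fun setT (fun w => f w ^+ 2) by apply: measurable_funX.
have i2 : L1 P (fun w => f w ^+ 2).
  apply/integrableP; split; first exact/measurable_EFinP.
  apply: le_lt_trans (ltry k); apply: le_trans fk.
  rewrite le_eqVlt; apply/orP; left; apply/eqP.
  by apply: eq_integral => w _ /=; rewrite ger0_norm ?sqr_ge0.
by split=> //; rewrite -lee_fin -L1_mean.
Qed.

Lemma err_measurable i : measurable_fun setT (err i).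
Proof. exact: measurable_funB. Qed.

Lemma Y_L1 i : L1 P (Y i).
Proof. by apply: L1_of_sqr => //; have [] := sqr_expectation_L1 _ (sqrY i). Qed.

Lemma Y_sqr_L1 i : L1 P (fun w => Y i w ^+ 2).
Proof. by have [] := sqr_expectation_L1 _ (sqrY i). Qed.

Lemma errE i : err i = (fun w => Y i w - mean P (Y i)).
Proof. by rewrite /err meanvE. Qed.

Lemma err_L1 i : L1 P (err i).
Proof. by rewrite errE; apply: L1B; [apply: Y_L1|apply: L1_cst]. Qed.

Lemma err_mean i : mean P (err i) = 0.
Proof.
rewrite errE meanB; [|exact: Y_L1|exact: L1_cst].
by rewrite mean_cst subrr.
Qed.

Lemma err_sqrE i : (fun w => err i w ^+ 2) =
  (fun w => Y i w ^+ 2 - (2 * mean P (Y i)) * Y i w + mean P (Y i) ^+ 2).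
Proof. by apply/funext => w; rewrite errE; ring. Qed.

Lemma err_sqr_L1 i : L1 P (fun w => err i w ^+ 2).
Proof.
rewrite err_sqrE; apply: L1D; last exact: L1_cst.
by apply: L1B; [apply: Y_sqr_L1|apply/L1Z/Y_L1].
Qed.

Lemma covarianceE_mean i k :
  covariance P (Y i) (Y k) = (\int[P]_w (err i w * err k w)%:E)%E.
Proof.
rewrite unlock /= unlock; apply: eq_integral => w _ /=.
by rewrite /err !mxE !expectation.unlock.
Qed.

Lemma varvE i : varv i 0 = mean P (fun w => err i w ^+ 2).
Proof.
rewrite mxE /variance covarianceE_mean -/(mean P (fun w => err i w * err i w)).
by congr mean; apply/funext => w; rewrite expr2.
Qed.

Lemma varv_gt0 i : 0 < varv i 0.
Proof.
have := varY i; rewrite /variance covarianceE_mean.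
have := L1_mul (err_measurable i) (err_measurable i) (err_sqr_L1 i) (err_sqr_L1 i).
move/L1_mean => ->; rewrite lte_fin varvE.
by congr (_ < mean P _); apply/funext => w; rewrite expr2.
Qed.

Lemma varv_le i : varv i 0 <= K.
Proof.
have [i2 mK] := sqr_expectation_L1 (measurable_funPT (Y i)) (sqrY i).
rewrite varvE err_sqrE meanD; last exact: L1_cst.
  rewrite mean_cst meanB //; last exact/L1Z/Y_L1.
  rewrite meanZ; last exact: Y_L1.
  have := sqr_ge0 (mean P (Y i)); lra.
by apply: L1B => //; apply/L1Z/Y_L1.
Qed.

Lemma err_orthogonal i k : i != k -> mean P (fun w => err i w * err k w) = 0.
Proof.
move=> ik.
have := @independent_mean_mul _ _ _ P n Y i k
  (fun x => x - meanv Y i 0) (fun x => x - meanv Y k 0) indY ik _ _ (err_L1 i) (err_L1 k).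
move=> -> //; last 2 first.
- exact: measurable_funB.
- exact: measurable_funB.
by rewrite -[X in X * _]/(mean P (err i)) err_mean mul0r.
Qed.

(** Independence thereby turns [B_n] into a weighted Gram matrix of the
    design, and the standardization of the errors into a componentwise one. *)
Lemma covmx_diag : covmx Y = diagc varv.
Proof.
apply/matrixP => i j; rewrite !mxE.
have [->|ij] := eqVneq i j; first by rewrite mulr1n.
by rewrite covarianceE_mean mulr0n; apply: err_orthogonal.
Qed.

Lemma noiseE i w :
  (invsqrtmx (covmx Y) *m (rvec Y w - meanv Y)) i 0 = err i w / Num.sqrt (varv i 0).
Proof.
rewrite covmx_diag invsqrtmx_diagc; last exact: varv_gt0.
by rewrite mul_diag_mx /err !mxE mulrC.
Qed.

(** The components of the errors are orthogonal, so the cross terms vanish. *)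
Lemma score_norm_mean :
  L1 P (fun w => norm2 (X^T *m (rvec Y w - meanv Y)) ^+ 2) /\
  mean P (fun w => norm2 (X^T *m (rvec Y w - meanv Y)) ^+ 2)
    = \tr (X^T *m covmx Y *m X).
Proof.
have E : (fun w => norm2 (X^T *m (rvec Y w - meanv Y)) ^+ 2)
    = (fun w => \sum_j (\sum_i X i j * err i w) ^+ 2).
  apply/funext => w; rewrite norm2_sqr; apply: eq_bigr => j _; congr (_ ^+ 2).
  by rewrite mxE; apply: eq_bigr => i _; rewrite /err !mxE.
have os j := orthogonal_sum_sqr (fun i => X i j) err_measurable err_sqr_L1 err_orthogonal.
rewrite E; split; first by apply: L1_sum => j; have [] := os j.
rewrite mean_sum; last by move=> j; have [] := os j.
rewrite covmx_diag -/(gramw X varv) trace_gramw.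
under eq_bigr => j _ do rewrite (proj2 (os j)).
rewrite exchange_big; apply: eq_bigr => i _ /=.
rewrite mulr_sumr; apply: eq_bigr => j _; rewrite -varvE mulrC.
by [].
Qed.

Hypothesis H_gt0 : 0 < H.
Hypothesis tailY : forall (i : 'I_n) (t : R), 0 <= t ->
  (P [set w | (t < `|(invsqrtmx (covmx Y) *m (rvec Y w - meanv Y)) i 0|)%R]
     <= (H * expR (- (t ^+ 2) / H))%:E)%E.

Definition std_err i w : R := err i w / Num.sqrt (varv i 0).
Definition expsq i w : R := expR (std_err i w ^+ 2 / (2 * H)).

Lemma expsq_moment i : L1 P (expsq i) /\ mean P (expsq i) <= (1 + H) * pi.
Proof.
apply: subgaussian_exp_moment => //.
  by apply: measurable_funM => //; apply: err_measurable.
move=> t t0; have := tailY i t0.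
rewrite (_ : [set w | (t < `|std_err i w|)%R] =
  [set w | (t < `|(invsqrtmx (covmx Y) *m (rvec Y w - meanv Y)) i 0|)%R]) //.
by apply/seteqP; split => w /=; rewrite noiseE.
Qed.

Lemma err_sqr_std_err i w : err i w ^+ 2 = varv i 0 * std_err i w ^+ 2.
Proof.
rewrite /std_err exprMn exprVn sqr_sqrtr; last exact/ltW/varv_gt0.
by rewrite mulrCA divff ?mulr1 // gt_eqF // varv_gt0.
Qed.

Lemma expR_ge_sqr (x : R) : 0 <= x -> x ^+ 2 <= 4 * expR x.
Proof.
move=> x0; have := expR_ge1Dx (x / 2); have -> : expR x = expR (x/2) ^+ 2.
  by rewrite -expRM_natl; congr expR; field.
have := expR_gt0 (x / 2); nra.
Qed.

Lemma err_pow4_le i w : err i w ^+ 4 <= 16 * H ^+ 2 * K ^+ 2 * expsq i w.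
Proof.
have -> : err i w ^+ 4 = varv i 0 ^+ 2 * std_err i w ^+ 4.
  by rewrite -[4%N]/(2 * 2)%N !exprM err_sqr_std_err exprMn.
have v2 : varv i 0 ^+ 2 <= K ^+ 2.
  have := varv_le i; have := varv_gt0 i; nra.
have s0 : 0 <= std_err i w ^+ 2 / (2 * H) by rewrite divr_ge0 ?sqr_ge0 // mulr_ge0 // ltW.
have s4 : std_err i w ^+ 4 <= 16 * H ^+ 2 * expsq i w.
  have := expR_ge_sqr s0.
  have -> : (std_err i w ^+ 2 / (2 * H)) ^+ 2 = std_err i w ^+ 4 / (4 * H ^+ 2).
    by field; rewrite gt_eqF.
  rewrite ler_pdivrMr ?mulr_gt0 ?exprn_gt0 // /expsq; lra.
have -> : 16 * H ^+ 2 * K ^+ 2 * expsq i w = K ^+ 2 * (16 * H ^+ 2 * expsq i w) by ring.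
apply: ler_pM => //; first exact: sqr_ge0.
by rewrite -[4%N]/(2 * 2)%N exprM sqr_ge0.
Qed.

Lemma err_pow4_L1 i : L1 P (fun w => err i w ^+ 4).
Proof.
apply: L1_le (L1Z (16 * H ^+ 2 * K ^+ 2) (proj1 (expsq_moment i))).
  exact/measurable_funX/err_measurable.
move=> w; rewrite ger0_norm; first exact: err_pow4_le.
by rewrite -[4%N]/(2 * 2)%N exprM sqr_ge0.
Qed.

Lemma err_pow4_mean i :
  mean P (fun w => err i w ^+ 4) <= 16 * H ^+ 2 * K ^+ 2 * ((1 + H) * pi).
Proof.
have [ie me] := expsq_moment i.
apply: le_trans (mean_le (err_pow4_L1 i) (L1Z _ ie) (fun w => err_pow4_le i w)) _.
by rewrite meanZ // ler_wpM2l //; apply: mulr_ge0; [apply: mulr_ge0|]; rewrite ?sqr_ge0 ?ler0n.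
Qed.

Variable bias : 'cV[R]_n.

(** The square [(err + bias)^2] minus its mean. *)
Definition fluct (w : T) : 'cV[R]_n :=
  \col_i (err i w ^+ 2 - varv i 0 + 2 * bias i 0 * err i w).

Lemma fluct_measurable i : measurable_fun setT (fun w => fluct w i 0).
Proof.
rewrite (_ : (fun w => _) =
  (fun w => err i w ^+ 2 - varv i 0 + 2 * bias i 0 * err i w)); last first.
  by apply/funext => w; rewrite mxE.
have me := err_measurable i.
apply: measurable_funD; last exact: measurable_funM.
by apply: measurable_funB => //; apply: measurable_funX.
Qed.

Lemma fluct_L1 i : L1 P (fun w => fluct w i 0).
Proof.
rewrite (_ : (fun w => _) =
  (fun w => err i w ^+ 2 - varv i 0 + 2 * bias i 0 * err i w)); last first.
  by apply/funext => w; rewrite mxE.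
apply: L1D; last exact/L1Z/err_L1.
by apply: L1B; [apply: err_sqr_L1|apply: L1_cst].
Qed.

Lemma fluct_mean i : mean P (fun w => fluct w i 0) = 0.
Proof.
rewrite (_ : (fun w => _) =
  (fun w => err i w ^+ 2 - varv i 0 + 2 * bias i 0 * err i w)); last first.
  by apply/funext => w; rewrite mxE.
rewrite meanD; last exact/L1Z/err_L1.
  rewrite meanB; [|exact: err_sqr_L1|exact: L1_cst].
  rewrite meanZ; last exact: err_L1.
  by rewrite err_mean mean_cst -varvE subrr mulr0 addr0.
by apply: L1B; [apply: err_sqr_L1|apply: L1_cst].
Qed.

Lemma fluct_orthogonal i k : i != k ->
  mean P (fun w => fluct w i 0 * fluct w k 0) = 0.
Proof.
move=> ik.
pose f j (x : R) := (x - meanv Y j 0) ^+ 2 - varv j 0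
                      + 2 * bias j 0 * (x - meanv Y j 0).
have mf j : measurable_fun setT (f j).
  have mx : measurable_fun setT (fun x : R => x - meanv Y j 0) by apply: measurable_funB.
  apply: measurable_funD; last exact: measurable_funM.
  by apply: measurable_funB => //; apply: measurable_funX.
have fE j : f j \o Y j = (fun w => fluct w j 0).
  by apply/funext => w; rewrite mxE.
have := @independent_mean_mul _ _ _ P n Y i k (f i) (f k) indY ik (mf i) (mf k).
rewrite !fE => /(_ (fluct_L1 i) (fluct_L1 k)); rewrite fluct_mean mul0r => E0.
rewrite -[RHS]E0; congr mean; apply/funext => w.
by rewrite -[f i (Y i w)]/((f i \o Y i) w) -[f k (Y k w)]/((f k \o Y k) w) !fE.
Qed.

Lemma fluct_sqr_le i w :
  fluct w i 0 ^+ 2 <= 2 * err i w ^+ 4 + 2 * K ^+ 2 + 8 * bias i 0 ^+ 2 * err i w ^+ 2.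
Proof.
rewrite mxE -[4%N]/(2 * 2)%N exprM.
set x := err i w ^+ 2; set y := 2 * bias i 0 * err i w.
have -> : 8 * bias i 0 ^+ 2 * x = 2 * y ^+ 2 by rewrite /y /x; ring.
have x0 : 0 <= x by apply: sqr_ge0.
have v0 := varv_gt0 i; have vK := varv_le i.
have h : (x - varv i 0) ^+ 2 <= x ^+ 2 + K ^+ 2 by nra.
have := sqr_ge0 (x - varv i 0 - y); nra.
Qed.

Lemma fluct_sqr_L1 i : L1 P (fun w => fluct w i 0 ^+ 2).
Proof.
apply: L1_le (L1D (L1D (L1Z 2 (err_pow4_L1 i)) (L1_cst P (2 * K ^+ 2)))
                  (L1Z (8 * bias i 0 ^+ 2) (err_sqr_L1 i))).
  exact/measurable_funX/fluct_measurable.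
by move=> w; rewrite ger0_norm ?sqr_ge0 ?fluct_sqr_le.
Qed.

Definition fluct_const : R := 32 * H ^+ 2 * K ^+ 2 * ((1 + H) * pi) + 2 * K ^+ 2.

Lemma fluct_sqr_mean i :
  mean P (fun w => fluct w i 0 ^+ 2) <= fluct_const + 8 * K * bias i 0 ^+ 2.
Proof.
have i4 := L1Z 2 (err_pow4_L1 i); have i2 := L1Z (8 * bias i 0 ^+ 2) (err_sqr_L1 i).
have ic := L1_cst P (2 * K ^+ 2); have i4c := L1D i4 ic.
apply: le_trans (mean_le (fluct_sqr_L1 i) (L1D i4c i2) (fun w => fluct_sqr_le i w)) _.
rewrite meanD // meanD // (meanZ _ (err_pow4_L1 i)) (meanZ _ (err_sqr_L1 i)).
rewrite mean_cst -varvE /fluct_const.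
have h4 := err_pow4_mean i.
have : 8 * bias i 0 ^+ 2 * varv i 0 <= 8 * bias i 0 ^+ 2 * K.
  by rewrite ler_wpM2l ?varv_le // mulr_ge0 ?sqr_ge0.
lra.
Qed.

(** Each entry of the Gram matrix is a linear combination of the orthogonal
    variables [fluct i]; summing the squared coefficients over the entries
    gives the square of [rowsq X i]. *)
Lemma fluct_gram_mean M : (forall i, rowsq X i <= M) ->
  L1 P (fun w => frob2 (gramw X (fluct w))) /\
  mean P (fun w => frob2 (gramw X (fluct w)))
    <= M ^+ 2 * (n%:R * fluct_const + 8 * K * \sum_i bias i 0 ^+ 2).
Proof.
move=> XM.
have E : (fun w => frob2 (gramw X (fluct w))) = (fun w =>
    \sum_j \sum_k (\sum_i (X i j * X i k) * fluct w i 0) ^+ 2).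
  apply/funext => w; apply: eq_bigr => j _; apply: eq_bigr => k _.
  by rewrite gramwE; congr (_ ^+ 2); apply: eq_bigr => i _; rewrite mulrC.
have os j k := orthogonal_sum_sqr (fun i => X i j * X i k)
  fluct_measurable fluct_sqr_L1 fluct_orthogonal.
have i1 j : L1 P (fun w => \sum_k (\sum_i (X i j * X i k) * fluct w i 0) ^+ 2).
  by apply: L1_sum => k; have [] := os j k.
rewrite E; split; first exact: L1_sum.
rewrite mean_sum //.
have -> : \sum_j mean P (fun w => \sum_k (\sum_i (X i j * X i k) * fluct w i 0) ^+ 2)
   = \sum_i rowsq X i ^+ 2 * mean P (fun w => fluct w i 0 ^+ 2).
  transitivity (\sum_j \sum_k \sum_i (X i j * X i k) ^+ 2 * mean P (fun w => fluct w i 0 ^+ 2)).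
    apply: eq_bigr => j _; rewrite mean_sum; last by move=> k; have [] := os j k.
    by apply: eq_bigr => k _; rewrite (proj2 (os j k)).
  under eq_bigr => j _ do rewrite exchange_big.
  rewrite exchange_big; apply: eq_bigr => i _ /=.
  rewrite expr2 /rowsq !mulr_suml; apply: eq_bigr => j _.
  rewrite mulr_sumr mulr_suml; apply: eq_bigr => k _.
  by rewrite exprMn.
have -> : M ^+ 2 * (n%:R * fluct_const + 8 * K * \sum_i bias i 0 ^+ 2) =
    \sum_(i < n) M ^+ 2 * (fluct_const + 8 * K * bias i 0 ^+ 2).
  rewrite -mulr_sumr big_split /= sumr_const card_ord mulr_natl -mulr_sumr.
  by [].
apply: ler_sum => i _; apply: ler_pM.
- exact: sqr_ge0.
- by apply: mean_ge0 => w; apply: sqr_ge0.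
- by rewrite ler_sqr ?nnegrE ?XM ?rowsq_ge0 // (le_trans (rowsq_ge0 X i)).
- exact: fluct_sqr_mean.
Qed.

End Noise.

Lemma fluct_const_ge0 (R : realType) (K H : R) : 0 <= H -> 0 <= fluct_const K H.
Proof.
move=> H0; have H1 : 0 <= (1 + H) * pi by rewrite mulr_ge0 ?pi_ge0 // addr_ge0.
have h (c x y : R) : 0 <= c -> 0 <= c * x ^+ 2 * y ^+ 2.
  by move=> c0; rewrite mulr_ge0 ?sqr_ge0 // mulr_ge0 ?sqr_ge0.
apply: addr_ge0; last by apply: mulr_ge0; rewrite ?sqr_ge0.
by apply: mulr_ge0 => //; apply: h.
Qed.

(** * Localization of the estimator *)

Section Localization.
Context {R : realType}.

Lemma psd_opbound n (M : 'M[R]_n) c : psdmx M -> 0 <= c ->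
  (forall v, quad M v <= c * norm2 v ^+ 2) -> opbound M c.
Proof.
move=> Mp c0 Mc; have [[Ss _] SM] := sqrtmx_spec Mp.
have Sc : opbound (sqrtmx M) (Num.sqrt c).
  move=> v; rewrite -ler_sqr ?nnegrE ?mulr_ge0 ?norm2_ge0 ?sqrtr_ge0 //.
  by rewrite sqrtmx_norm2 // exprMn sqr_sqrtr.
have := opboundM (sqrtr_ge0 c) Sc Sc.
by rewrite SM -expr2 sqr_sqrtr.
Qed.

Lemma glm_info_sym (b : R -> R) n d (X : 'M[R]_(n, d)) beta :
  (glm_info b X beta)^T = glm_info b X beta.
Proof. exact: gramw_sym. Qed.

(** The eigenvalue bound on [B^(-1/2) A B^(-1/2)] at the vector [B^(1/2) u]. *)
Lemma lambda_min_relative n (A B : 'M[R]_n) c m : A^T = A ->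
  (forall v, 0 <= quad A v) -> psdmx B -> 0 < m ->
  (forall v, m * norm2 v ^+ 2 <= quad B v) ->
  c <= lambda_min (invsqrtmx B *m A *m invsqrtmx B) ->
  forall u, c * quad B u <= quad A u.
Proof.
move=> As A0 Bp m0 Bm cV u.
have [[Ss _] SB] := sqrtmx_spec Bp.
have Su : sqrtmx B \in unitmx.
  by have := coercive_unitmx m0 Bm; rewrite -{1}SB unitmx_mul => /andP[].
have Vq v : quad (invsqrtmx B *m A *m invsqrtmx B) v = quad A (invsqrtmx B *m v).
  by rewrite /quad trmx_mul /invsqrtmx trmx_inv Ss !mulmxA.
have Vp : psdmx (invsqrtmx B *m A *m invsqrtmx B).
  split=> [|v]; last by rewrite -/(quad _ _) Vq.
  by rewrite !trmx_mul /invsqrtmx trmx_inv Ss As mulmxA.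
have := lambda_min_quad (sqrtmx B *m u) Vp cV.
by rewrite Vq /invsqrtmx mulKmx // sqrtmx_norm2.
Qed.

Variable b : R -> R.
Hypothesis b_cumulant : cumulant_function b.
Variables (n d : nat) (X : 'M[R]_(n, d)) (B : 'M[R]_d) (m rho : R).
Hypothesis n_gt0 : (0 < n)%N.
Hypothesis B_psd : psdmx B.
Hypothesis m_gt0 : 0 < m.
Hypothesis B_coercive : forall v, m * norm2 v ^+ 2 <= quad (n%:R^-1 *: B) v.

Let nR_gt0 : 0 < n%:R :> R.
Proof. by rewrite ltr0n. Qed.

Lemma scaled_psd : psdmx (n%:R^-1 *: B).
Proof.
have [Bs B0] := B_psd; split; first by rewrite linearZ /= Bs.
by move=> v; rewrite -/(quad _ _) quadZ mulr_ge0 ?invr_ge0 ?ler0n // B0.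
Qed.

Lemma nbhd_norm_sqr u :
  norm2 (sqrtmx (n%:R^-1 *: B) *m u) ^+ 2 = quad (n%:R^-1 *: B) u.
Proof. by rewrite sqrtmx_norm2 //; apply: scaled_psd. Qed.

Lemma nbhd_norm_ge u :
  Num.sqrt m * norm2 u <= norm2 (sqrtmx (n%:R^-1 *: B) *m u).
Proof.
rewrite -ler_sqr ?nnegrE ?mulr_ge0 ?norm2_ge0 ?sqrtr_ge0 //.
by rewrite exprMn (sqr_sqrtr (ltW m_gt0)) nbhd_norm_sqr; apply: B_coercive.
Qed.

(** If the estimator were outside of the neighbourhood, the segment from
    [beta] to it would leave the neighbourhood at the fraction [t] of its
    length. Up to that point the curvature is at least [c] relative to [B],
    and [QMLE_score_bound] at [t] forces the score at [beta] to be large. *)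
Lemma QMLE_localized c y ybar beta betahat :
  0 < c ->
  (forall beta', norm2 (sqrtmx (n%:R^-1 *: B) *m (beta' - beta)) <= rho ->
     c <= lambda_min (invsqrtmx B *m glm_info b X beta' *m invsqrtmx B)) ->
  is_QMLE b X ybar beta -> is_QMLE b X y betahat ->
  norm2 (X^T *m (y - ybar)) < c * rho * n%:R * Num.sqrt m ->
  norm2 (sqrtmx (n%:R^-1 *: B) *m (betahat - beta)) <= rho.
Proof.
move=> c0 curv opt opthat small; rewrite leNgt; apply/negP => far.
set S := sqrtmx _ in curv far.
set u := betahat - beta in far.
have sm0 : 0 < Num.sqrt m by rewrite sqrtr_gt0.
have rho0 : 0 < rho.
  have := le_lt_trans (norm2_ge0 _) small.
  by rewrite (pmulr_lgt0 _ sm0) (pmulr_lgt0 _ nR_gt0) pmulr_rgt0.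
have Su0 : 0 < norm2 (S *m u) by apply: lt_trans far.
(* The fraction of the segment at which it leaves the neighbourhood. *)
pose t := rho / norm2 (S *m u).
have t01 : 0 < t <= 1.
  by rewrite /t divr_gt0 //= ler_pdivrMr // mul1r ltW.
have uE : betahat = beta + u by rewrite /u addrC subrK.
have [s /andP[s0 st] bound] := QMLE_score_bound b_cumulant opt
  (eq_ind _ (is_QMLE b X y) opthat _ uE) t01.
have Bc v : (n%:R * m) * norm2 v ^+ 2 <= quad B v.
  by have := B_coercive v; rewrite quadZ ler_pdivlMl // mulrA.
have nm0 : 0 < n%:R * m by rewrite mulr_gt0.
have near : norm2 (S *m (beta + s *: u - beta)) <= rho.
  rewrite addrAC subrr add0r -scalemxAr norm2Z gtr0_norm //.
  have : s * norm2 (S *m u) <= t * norm2 (S *m u) by rewrite ler_pM2r // ltW.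
  by rewrite /t divfK // gt_eqF.
have rel := lambda_min_relative (glm_info_sym b X _)
  (glm_info_ge0 b_cumulant X _) B_psd nm0 Bc (curv _ near) u.
have BS : quad B u = n%:R * norm2 (S *m u) ^+ 2.
  by rewrite nbhd_norm_sqr quadZ mulrA divff ?mul1r // gt_eqF.
have up : 0 <= norm2 u by apply: norm2_ge0.
have low := nbhd_norm_ge u; rewrite -/S in low.
have u0 : 0 < norm2 u.
  rewrite lt0r up andbT; apply: contraTneq Su0 => u0.
  by rewrite (norm2_eq0 u0) mulmx0 /norm2 big1 ?sqrtr0 ?ltxx // => i _; rewrite mxE expr0n.
have inner : c * rho * n%:R * norm2 (S *m u) <=
    norm2 (X^T *m (y - ybar)) * norm2 u.
  apply: le_trans (dot_norm2 _ _); apply: le_trans (ler_norm _).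
  apply: le_trans bound; have tp : 0 < t by case/andP: t01.
  apply: (@le_trans _ _ (t * (c * quad B u))); last by rewrite ler_pM2l.
  rewrite BS /t expr2 le_eqVlt; apply/orP; left; apply/eqP.
  by field; rewrite gt_eqF.
have : c * rho * n%:R * (Num.sqrt m * norm2 u) <= c * rho * n%:R * norm2 (S *m u).
  by rewrite ler_wpM2l // !mulr_ge0 // ltW.
move=> /le_trans /(_ inner); rewrite mulrA ler_pM2r // leNgt.
by rewrite small.
Qed.

End Localization.

(** * Decomposition of the squared residuals *)

Section Decomposition.
Context {R : realType}.
Variables (n d : nat) (X : 'M[R]_(n, d)).

(** For nonnegative weights [wnorm] is the trace of the Gram matrix, which
    vanishes at [beta0] and is at most [d] times its operator norm. *)
Lemma lipschitz_wnorm (L : R) (D : set 'cV[R]_d) (h : 'cV[R]_d -> 'cV[R]_n)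
    beta0 beta : (0 < n)%N ->
  lipschitz_opnorm L D (fun be => n%:R^-1 *: (X^T *m diagc (h be) *m X)) ->
  D beta0 -> D beta -> h beta0 = 0 -> (forall i, 0 <= h beta i 0) ->
  wnorm X (h beta) <= n%:R * (d%:R * (L * norm2 (beta - beta0))).
Proof.
move=> n0 lip D0 D1 h0 hpos.
have nR : 0 < n%:R :> R by rewrite ltr0n.
have := lip beta beta0 D1 D0; rewrite h0 -!/(gramw X _).
have -> : gramw X 0 = 0 by rewrite -(scale0r 0) gramwZ scale0r.
rewrite scaler0 subr0 => le.
have := opbound_trace (opnorm_opbound (n%:R^-1 *: gramw X (h beta))).
rewrite linearZ /= trace_gramw.
have -> : \sum_i h beta i 0 * rowsq X i = wnorm X (h beta).
  by apply: eq_bigr => i _; rewrite ger0_norm.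
rewrite ger0_norm; last by rewrite mulr_ge0 ?invr_ge0 ?ler0n ?wnorm_ge0.
rewrite ler_pdivrMl // => /le_trans; apply.
by rewrite ler_pM2l // ler_wpM2l.
Qed.

(** The part of [(e + bias - shift)^2] other than [e^2 + 2 bias e]. *)
Definition rest (bias shift : 'cV[R]_n) (e : 'I_n -> R) : 'cV[R]_n :=
  \col_i (bias i 0 ^+ 2 - 2 * (e i + bias i 0) * shift i 0 + shift i 0 ^+ 2).

(** The products of the bias with the shift are absorbed in their squares,
    while the product of the error with the shift is bounded by the maximal
    error: the Cauchy-Schwarz inequality would be too weak there, as the
    errors are not small. *)
Lemma rest_wnorm bias shift e s : (forall i, `|e i| <= s) ->
  wnorm X (rest bias shift e) <=
    2 * wnorm X (hadamard bias bias) + 2 * s * wnorm X (absv shift)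
    + 2 * wnorm X (hadamard shift shift).
Proof.
move=> es; rewrite /wnorm !mulr_sumr -!big_split /=.
apply: ler_sum => i _; rewrite !mxE.
rewrite !mulrA -!mulrDl ler_wpM2r ?rowsq_ge0 //.
have := es i; move: (e i) (bias i 0) (shift i 0) => x y z xs.
rewrite normr_id !normrM -!expr2 !real_normK ?num_real //.
have hz := normr_ge0 z.
have h1 : `|x * z| <= s * `|z| by rewrite normrM ler_wpM2r.
have h2 := sqr_ge0 (y + z); have h3 := sqr_ge0 (y - z).
move: h1; rewrite !ler_norml => /andP[h1 h1'].
have y2 := sqr_ge0 y; have z2 := sqr_ge0 z.
apply/andP; split; nra.
Qed.

Lemma residual_gram (y ybar mu0 muhat v : 'cV[R]_n) :
  let bias := ybar - mu0 in
  let shift := muhat - mu0 in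
  let e i := y i 0 - ybar i 0 in
  X^T *m diagc (hadamard (y - muhat) (y - muhat)) *m X
  = gramw X v + gramw X (\col_i (e i ^+ 2 - v i 0 + 2 * bias i 0 * e i))
    + gramw X (rest bias shift e).
Proof.
move=> bias shift e; rewrite -!gramwD; congr (_ *m diagc _ *m _).
apply/colP => i; rewrite /e /bias /shift !mxE; ring.
Qed.

End Decomposition.

(** * Measurability of the deviation sets *)

Section MatrixMeasurability.
Context {R : realType} {disp : measure_display} {T : measurableType disp}.

Definition mx_measurable p q (F : T -> 'M[R]_(p, q)) : Prop :=
  forall i j, measurable_fun setT (fun w => F w i j).

Lemma mx_measurable_mul p q s (F : T -> 'M[R]_(p, q)) (G : T -> 'M[R]_(q, s)) :
  mx_measurable F -> mx_measurable G -> mx_measurable (fun w => F w *m G w).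
Proof.
move=> mF mG i j.
rewrite (_ : (fun w => _) = fun w => \sum_k F w i k * G w k j).
  by apply: measurable_sum => k; apply: measurable_funM.
by apply/funext => w; rewrite mxE.
Qed.

Lemma mx_measurable_cst p q (M : 'M[R]_(p, q)) : mx_measurable (fun=> M).
Proof. by move=> i j; apply: measurable_cst. Qed.

Lemma mx_measurable_det p (F : T -> 'M[R]_p) : mx_measurable F ->
  measurable_fun setT (fun w => \det (F w)).
Proof.
move=> mF; rewrite /determinant; apply: measurable_sum => s.
apply: measurable_funM => //.
by apply: measurable_prod => i _; apply: mF.
Qed.

Lemma mx_measurable_trace p (F : T -> 'M[R]_p) : mx_measurable F ->
  measurable_fun setT (fun w => \tr (F w)).
Proof. by move=> mF; rewrite /mxtrace; apply: measurable_sum => i; apply: mF. Qed.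

Lemma mx_measurable_adj p (F : T -> 'M[R]_p) : mx_measurable F ->
  mx_measurable (fun w => \adj (F w)).
Proof.
move=> mF i j.
rewrite (_ : (fun w => _) = fun w => cofactor (F w) j i); last first.
  by apply/funext => w; rewrite mxE.
rewrite /cofactor; apply: measurable_funM => //.
apply: mx_measurable_det => k l.
rewrite (_ : (fun w => _) = fun w => F w (lift j k) (lift i l)); first exact: mF.
by apply/funext => w; rewrite !mxE.
Qed.

Lemma measurable_inv_gt0 (f : T -> R) : measurable_fun setT f ->
  (forall w, 0 < f w) -> measurable_fun setT (fun w => (f w)^-1).
Proof.
move=> mf f0; rewrite (_ : (fun w => _) = fun w => expR (- ln (f w))).
  apply: measurableT_comp => //; apply: measurable_funN.
  by apply: measurableT_comp => //; apply: measurable_ln.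
by apply/funext => w; rewrite expRN lnK // posrE.
Qed.

Lemma mx_measurable_inv p (F : T -> 'M[R]_p) : mx_measurable F ->
  (forall w, 0 < \det (F w)) -> mx_measurable (fun w => invmx (F w)).
Proof.
move=> mF F0 i j.
rewrite (_ : (fun w => _) = fun w => (\det (F w))^-1 * (\adj (F w)) i j).
  apply: measurable_funM; last exact: mx_measurable_adj.
  by apply: measurable_inv_gt0 => //; apply: mx_measurable_det.
by apply/funext => w; rewrite /invmx unitmxE unitfE gt_eqF // mxE.
Qed.

Lemma mx_measurable_gramw p q (X : 'M[R]_(p, q)) (v : T -> 'cV[R]_p) :
  (forall i, measurable_fun setT (fun w => v w i 0)) ->
  mx_measurable (fun w => gramw X (v w)).
Proof.
move=> mv i j; rewrite (_ : (fun w => _) =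
  fun w => \sum_k v w k 0 * (X k i * X k j)); last first.
  by apply/funext => w; rewrite gramwE.
by apply: measurable_sum => k; apply: measurable_funM.
Qed.

Lemma measurable_lt_set (f : T -> R) c : measurable_fun setT f ->
  measurable [set w | c < f w].
Proof.
move=> mf; rewrite (_ : [set w | _] = f @^-1` `]c, +oo[%classic).
  by rewrite -[X in measurable X]setTI; apply: mf.
by apply/seteqP; split => w /=; rewrite in_itv /= andbT.
Qed.

Lemma measurable_deviation (f : T -> R) c eps : measurable_fun setT f ->
  measurable [set w | (eps%:E < `|(f w - c)%:E|)%E].
Proof.
move=> mf; rewrite (_ : [set w | _] = [set w | eps < `|f w - c|]).
  apply: measurable_lt_set; apply: measurableT_comp => //.
  exact: measurable_funB.
by apply/seteqP; split => w /=; rewrite lte_fin.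
Qed.

(** The determinant may be nonpositive, where the extended logarithm is [-oo]
    and the deviation infinite; this part of the set is measurable by itself. *)
Lemma measurable_lne_deviation (f : T -> R) h eps : measurable_fun setT f ->
  0 < h ->
  measurable [set w | (eps%:E < `|lne (f w)%:E - lne h%:E|)%E].
Proof.
move=> mf h0; rewrite (_ : [set w | _] =
   ~` [set w | 0 < f w] `|` ([set w | 0 < f w] `&`
   [set w | eps < `|ln (f w) - ln h| ])); last first.
  apply/seteqP; split=> w; rewrite /setU /setI /setC /mkset.
    have [f0|f0] := ltP 0 (f w); last by left.
    by rewrite !lne_EFin // -EFinB lte_fin; right.
  case=> [/negP|[f0]]; last by rewrite !lne_EFin // -EFinB lte_fin.
  by rewrite -leNgt => f0; rewrite le0_lneNy ?lee_fin // lne_EFin // ltry.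
have m1 := measurable_lt_set 0 mf.
apply: measurableU; first exact: measurableC.
apply: measurableI => //; apply: measurable_lt_set; apply: measurableT_comp => //.
by apply: measurable_funB => //; apply: measurableT_comp => //; apply: measurable_ln.
Qed.

End MatrixMeasurability.

Lemma cumulant_measurable (R : realType) (b : R -> R) : cumulant_function b ->
  measurable_fun setT (derive1 b) /\ measurable_fun setT (derive1n 2 b).
Proof.
move=> bc; split; apply: continuous_measurable_fun; last by have [] := bc.
move=> x; apply: differentiable_continuous.
by apply/derivable1_diffP; have [] := cumulant_derive2 bc x.
Qed.

(** * Rates of convergence *)

Lemma bigO_powR_le (R : realType) (f : nat -> R) (s : R) :
  f =O_\oo (fun n => n%:R `^ s : R) ->
  exists2 C, 0 < C & \forall n \near \oo, f n <= C * n%:R `^ s.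
Proof.
move/eqO_exP => [C C0 fC]; exists C => //; apply: filterS fC => n fn.
by apply: le_trans (ler_norm _) _; rewrite [`|_ `^ _|]ger0_norm ?powR_ge0 in fn.
Qed.

Section Rates.
Context {R : realType}.

Lemma powR_add (x s t : R) : 0 < x -> x `^ (s + t) = x `^ s * x `^ t.
Proof. by move=> x0; rewrite powRD // (gt_eqF x0) implybT. Qed.

Lemma near_powRN_lt (p e : R) : 0 < p -> 0 < e ->
  \forall n \near \oo, n%:R `^ (- p) < e.
Proof.
move=> p0 e0; near=> n.
have n0 : 0 < n%:R :> R by rewrite ltr0n; near: n; exists 1%N.
have big : (e^-1) `^ p^-1 < n%:R.
  by near: n; apply: nbhs_infty_gtr.
rewrite powRN -[ltRHS]invrK ltf_pV2 ?posrE ?powR_gt0 ?invr_gt0 //.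
have : (e^-1 `^ p^-1) `^ p < n%:R `^ p.
  by rewrite gt0_ltr_powR // nnegrE ?powR_ge0 ?ltW.
by rewrite -powRrM mulVf ?gt_eqF // powRr1 // invr_ge0 ltW.
Unshelve. all: by end_near.
Qed.

Lemma ln_le_powR (p : R) n : 0 < p -> (0 < n)%N ->
  ln (n%:R : R) <= p^-1 * n%:R `^ p.
Proof.
move=> p0 n0; have nR : 0 < n%:R :> R by rewrite ltr0n.
rewrite ler_pdivlMl // -ln_powR.
have xp : 0 < n%:R `^ p :> R by rewrite powR_gt0.
have := @le_ln1Dx R (n%:R `^ p - 1).
have -> : 1 + (n%:R `^ p - 1) = n%:R `^ p :> R by ring.
by move=> le; apply: le_trans (le _) _; lra.
Qed.

Lemma near_powRN_ln_lt (p e : R) : 0 < p -> 0 < e ->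
  \forall n \near \oo, n%:R `^ (- p) * ln n%:R < e.
Proof.
move=> p0 e0; have p2 : 0 < p / 2 by rewrite divr_gt0.
have e' : 0 < p / 2 * e by rewrite mulr_gt0.
near=> n.
have n0 : (0 < n)%N by near: n; exists 1%N.
have nR : 0 < n%:R :> R by rewrite ltr0n.
have small : n%:R `^ (- (p / 2)) < p / 2 * e by near: n; apply: near_powRN_lt.
apply: (@le_lt_trans _ _ (n%:R `^ (- p) * ((p / 2)^-1 * n%:R `^ (p / 2)))).
  by rewrite ler_wpM2l ?powR_ge0 // ln_le_powR.
rewrite mulrCA -powR_add //.
have -> : - p + p / 2 = - (p / 2) by field.
by rewrite ltr_pdivrMl.
Unshelve. all: by end_near.
Qed.

Lemma littleo_powR_le (d : nat -> nat) (s : R) :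
  (fun n => (d n)%:R : R) =o_\oo (fun n => n%:R `^ s : R) ->
  \forall n \near \oo, (d n)%:R <= n%:R `^ s :> R.
Proof.
move/eqoP => /(_ 1 ltr01); apply: filterS => n.
by rewrite mul1r ger0_norm // ger0_norm ?powR_ge0.
Qed.

Variables (d : nat -> nat) (r alpha : R).
Hypothesis r_gt0 : 0 < r.
Hypothesis r_lt : r < 1 / 4.
Hypothesis alpha_lt : alpha < r.
Hypothesis d_le : \forall n \near \oo, (d n)%:R <= n%:R `^ ((1 - 4 * r) / 4) :> R.

(** Bounds [d] times the radius of the neighbourhood, the last factor being
    the size of the largest error: the product is of the order of [d^(3/2)
    n^(r - 1/2) ln n]. *)
Lemma near_radius_small (c0 s e : R) : 0 < c0 -> 0 <= s -> 0 < e ->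
  \forall n \near \oo, (d n)%:R *
    ((n%:R / (d n)%:R) `^ (- (1 / 2)) * nbhd_radius c0 r n)
      * (1 + Num.sqrt (s * ln n%:R)) < e.
Proof.
move=> c00 s0 e0; have q0 : 0 < 1 / 8 + r / 2 by have := r_gt0; lra.
pose C := Num.sqrt c0 * (1 + Num.sqrt s).
have C0 : 0 < C by rewrite mulr_gt0 ?sqrtr_gt0 // ltr_pwDl ?sqrtr_ge0.
near=> n.
have n3 : (3 <= n)%N by near: n; exists 3%N.
have nR : 0 < n%:R :> R by rewrite ltr0n (leq_trans _ n3).
have ln1 : 1 <= ln (n%:R : R).
  near: n; have : \forall n \near \oo, expR (1 : R) < n%:R by apply: nbhs_infty_gtr.
  apply: filterS => n en; rewrite -[leLHS]expRK ler_ln ?posrE ?expR_gt0 ?ltW //.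
  by apply: lt_trans en; apply: expR_gt0.
have dn : (d n)%:R <= n%:R `^ ((1 - 4 * r) / 4) :> R by near: n.
have small : n%:R `^ (- (1 / 8 + r / 2)) * ln n%:R < C^-1 * e.
  by near: n; apply: near_powRN_ln_lt; rewrite // mulr_gt0 ?invr_gt0.
have [d0|dpos] := posnP (d n); first by rewrite d0 !mul0r.
have dR : 0 < (d n)%:R :> R by rewrite ltr0n.
have ln0 : 0 <= ln (n%:R : R) by lra.
have lnsq : Num.sqrt (ln (n%:R:R)) ^+ 2 = ln n%:R by rewrite sqr_sqrtr.
have lnge1 : 1 <= Num.sqrt (ln (n%:R:R)) by rewrite -[leLHS]sqrtr1 ler_sqrt.
have dE : (d n)%:R * (n%:R / (d n)%:R) `^ (- (1 / 2)) <=
    n%:R `^ (3 * (1 - 4 * r) / 8 - 1 / 2) :> R.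
  have -> : (n%:R / (d n)%:R) `^ (- (1 / 2)) =
      n%:R `^ (- (1/2)) * (d n)%:R `^ (1/2) :> R.
    rewrite powRM ?invr_ge0 ?ltW //; congr (_ * _).
    by rewrite -powR_inv1 ?ltW // -powRrM mulN1r opprK.
  rewrite mulrCA -[X in _ * (X * _)](powRr1 (ltW dR)) -powR_add //.
  rewrite [leRHS]powR_add //.
  rewrite mulrC ler_wpM2r ?powR_ge0 //.
  apply: (@le_trans _ _ ((n%:R `^ ((1 - 4 * r) / 4)) `^ (1 + 1 / 2))).
    by rewrite ge0_ler_powR // ?nnegrE ?powR_ge0 ?ltW //; lra.
  rewrite -powRrM le_eqVlt; apply/orP; left; apply/eqP; congr powR.
  by field.
have sqE : Num.sqrt (c0 * ln n%:R) * (1 + Num.sqrt (s * ln n%:R)) <= C * ln n%:R.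
  rewrite (sqrtrM _ (ltW c00)) (sqrtrM _ s0) /C -[X in _ <= _ * X]lnsq.
  set x := Num.sqrt (ln _) in lnge1 *.
  have := sqrtr_ge0 c0; have := sqrtr_ge0 s.
  move: (Num.sqrt c0) (Num.sqrt s) => y z z0 y0.
  have : y * x * (1 + z * x) <= y * x * (x + z * x).
    by rewrite ler_wpM2l ?mulr_ge0 //; lra.
  move=> h; apply: le_trans h _; rewrite le_eqVlt; apply/orP; left; apply/eqP; ring.
apply: (@le_lt_trans _ _ (n%:R `^ (3 * (1 - 4 * r) / 8 - 1 / 2) * n%:R `^ r
    * (C * ln n%:R))).
  rewrite /nbhd_radius.
  have -> : forall x y z u v : R, x * (y * (z * u)) * v = (x * y) * z * (u * v).
    by move=> *; ring.
  apply: ler_pM => //.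
  by rewrite ler_wpM2r ?powR_ge0.
rewrite -powR_add //.
have -> : 3 * (1 - 4 * r) / 8 - 1 / 2 + r = - (1 / 8 + r / 2) by field.
by rewrite mulrCA -ltr_pdivlMl.
Unshelve. all: by end_near.
Qed.

Lemma near_bias_small (e : R) : 0 < e ->
  \forall n \near \oo, (d n)%:R * n%:R `^ (2 * r - 1 / 2) < e.
Proof.
move=> e0; have q0 : 0 < 1 / 4 - r by have := r_lt; lra.
near=> n.
have n0 : (0 < n)%N by near: n; exists 1%N.
have nR : 0 < n%:R :> R by rewrite ltr0n.
have dn : (d n)%:R <= n%:R `^ ((1 - 4 * r) / 4) :> R by near: n.
apply: (@le_lt_trans _ _ (n%:R `^ (- (1 / 4 - r)))).
  have -> : - (1 / 4 - r) = (1 - 4 * r) / 4 + (2 * r - 1 / 2) by field.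
  rewrite [leRHS]powR_add //.
  by rewrite ler_wpM2r ?powR_ge0.
by near: n; apply: near_powRN_lt.
Unshelve. all: by end_near.
Qed.

Lemma near_fluct_small (e : R) : 0 < e ->
  \forall n \near \oo, (d n)%:R ^+ 3 * n%:R `^ (4 * alpha - 1) < e.
Proof.
move=> e0; have q0 : 0 < 1 / 4 - 4 * alpha + 3 * r.
  by have := r_lt; have := alpha_lt; lra.
near=> n.
have n0 : (0 < n)%N by near: n; exists 1%N.
have nR : 0 < n%:R :> R by rewrite ltr0n.
have dn : (d n)%:R <= n%:R `^ ((1 - 4 * r) / 4) :> R by near: n.
apply: (@le_lt_trans _ _ (n%:R `^ (- (1 / 4 - 4 * alpha + 3 * r)))).
  have -> : - (1 / 4 - 4 * alpha + 3 * r) =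
      (1 - 4 * r) / 4 * 3%:R + (4 * alpha - 1) by field.
  rewrite [leRHS]powR_add //.
  rewrite powRrM powR_mulrn ?powR_ge0 // ler_wpM2r ?powR_ge0 //.
  by rewrite lerXn2r ?nnegrE ?powR_ge0.
by near: n; apply: near_powRN_lt.
Unshelve. all: by end_near.
Qed.

Lemma near_ln_gt (M : R) : \forall n \near \oo, M < ln (n%:R : R).
Proof.
have : \forall n \near \oo, expR M < n%:R by apply: nbhs_infty_gtr.
apply: filterS => n en; rewrite -[ltLHS]expRK ltr_ln ?posrE ?expR_gt0 //.
by apply: lt_trans en; apply: expR_gt0.
Qed.

End Rates.

(** * The comparison at a fixed sample size *)

Section PerSampleSize.
Context {R : realType} {disp : measure_display} {T : measurableType disp}.
Variables (P : probability T R) (n d : nat) (Y : 'I_n -> {RV P >-> R}).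
Variables (X : 'M[R]_(n, d)) (K : R).
Hypothesis indY : independent_family Y.
Hypothesis sqrY : forall i, ('E_P[fun w => (Y i w ^+ 2)%R] <= K%:E)%E.
Hypothesis varY : forall i, (0 < 'V_P[Y i])%E.

Let B := X^T *m covmx Y *m X.

Lemma score_covE : B = gramw X (varv Y).
Proof. by rewrite /B (covmx_diag indY sqrY). Qed.

Lemma score_cov_sym : B^T = B.
Proof. by rewrite score_covE gramw_sym. Qed.

Lemma score_cov_psd : psdmx B.
Proof.
split; first exact: score_cov_sym.
move=> v; rewrite -/(quad _ _) score_covE quad_gramw; apply: sumr_ge0 => i _.
by rewrite mulr_ge0 ?sqr_ge0 // ltW // (varv_gt0 sqrY varY).
Qed.

(** Both matrices are Gram matrices of the same design, with weights bounded
    below by [m0] and above by [K] respectively. *)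
Lemma glm_info_coercive (b : R -> R) (m0 m : R) : 0 < m0 -> 0 < K ->
  (forall t, m0 <= derive1n 2 b t) ->
  (forall v, m * norm2 v ^+ 2 <= quad B v) ->
  forall beta v, m0 * m / K * norm2 v ^+ 2 <= quad (glm_info b X beta) v.
Proof.
move=> m00 K0 bm Bm beta v.
apply: (@le_trans _ _ (m0 / K * quad B v)).
  have -> : m0 * m / K * norm2 v ^+ 2 = m0 / K * (m * norm2 v ^+ 2) by ring.
  by rewrite ler_wpM2l // divr_ge0 // ltW.
rewrite score_covE quad_gramw quad_glm_info mulr_sumr; apply: ler_sum => i _.
rewrite mulrA ler_wpM2r ?sqr_ge0 //; apply: le_trans (bm _).
rewrite mulrAC ler_pdivrMr // ler_pM2l //.
exact: (varv_le sqrY).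
Qed.

Lemma rowsq_le_mx_norm (c : R) : mx_norm X <= c ->
  forall i, rowsq X i <= d%:R * c ^+ 2.
Proof.
move=> Xc i; have -> : d%:R * c ^+ 2 = \sum_(j < d) c ^+ 2 :> R.
  by rewrite sumr_const card_ord mulr_natl.
apply: ler_sum => j _; rewrite -real_normK ?num_real //.
have Xij : `|X i j| <= c.
  apply: le_trans Xc; rewrite mx_normrE.
  exact: (le_bigmax _ (fun ij : 'I_n * 'I_d => `|X ij.1 ij.2|) (i, j)).
have c0 : 0 <= c by apply: le_trans Xij.
by rewrite ler_sqr.
Qed.

Variable bias : 'cV[R]_n.

(** The Cauchy-Schwarz inequality against the constant 1, after clearing the
    variances, which are at most [K]. *)
Lemma bias_sum_le (q : R) : 0 < K -> 0 <= q ->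
  \sum_i (bias i 0 ^+ 2 / varv Y i 0) ^+ 2 <= q ^+ 2 ->
  \sum_i bias i 0 ^+ 2 <= K * q * Num.sqrt n%:R.
Proof.
move=> K0 q0 qle.
rewrite -ler_sqr ?nnegrE ?mulr_ge0 ?sqrtr_ge0 ?(ltW K0) //; last first.
  by apply: sumr_ge0 => i _; apply: sqr_ge0.
have -> : \sum_i bias i 0 ^+ 2 = \sum_(i < n) bias i 0 ^+ 2 * 1.
  by apply: eq_bigr => i _; rewrite mulr1.
apply: le_trans (cauchy_schwarz _ _) _.
rewrite [X in _ * X](_ : _ = n%:R); last first.
  by under eq_bigr do rewrite expr1n; rewrite sumr_const card_ord.
rewrite [leRHS]exprMn (sqr_sqrtr (ler0n _ _)) ler_wpM2r // exprMn.
apply: (@le_trans _ _ (K ^+ 2 * \sum_i (bias i 0 ^+ 2 / varv Y i 0) ^+ 2)).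
  rewrite mulr_sumr; apply: ler_sum => i _; rewrite -exprMn.
  have v0 := varv_gt0 sqrY varY i; have vK := varv_le sqrY i.
  rewrite ler_sqr ?nnegrE ?sqr_ge0 //; last first.
    by rewrite mulr_ge0 ?(ltW K0) // divr_ge0 ?sqr_ge0 // ltW.
  rewrite mulrA ler_pdivlMr // mulrC ler_wpM2r ?sqr_ge0 //.
by rewrite ler_wpM2l ?sqr_ge0.
Qed.

Lemma wnorm_bias_le (M S : R) : (forall i, rowsq X i <= M) ->
  \sum_i bias i 0 ^+ 2 <= S -> 0 <= M -> wnorm X (hadamard bias bias) <= M * S.
Proof.
move=> XM bS M0; apply: (@le_trans _ _ (M * \sum_i bias i 0 ^+ 2)).
  rewrite mulr_sumr; apply: ler_sum => i _.
  rewrite mxE -expr2 ger0_norm ?sqr_ge0 // mulrC.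
  by rewrite ler_wpM2r ?sqr_ge0.
by rewrite ler_wpM2l.
Qed.

(** The outcome [w] is fixed here: the hypotheses on [w] hold outside of the
    exceptional event of [bad_event]. *)
Lemma plugin_good_event (b : R -> R) (beta0 bhat : 'cV[R]_d) (w : T)
    (m0 mB KB c rho L s tau : R) :
  let bi := meanv Y - glm_mean b (X *m beta0) in
  let nb := [set beta | norm2 (sqrtmx (n%:R^-1 *: B) *m (beta - beta0)) <= rho] in
  let shift beta := glm_mean b (X *m beta) - glm_mean b (X *m beta0) in
  let res := rvec Y w - glm_mean b (X *m bhat) in
  let A := glm_info b X beta0 in
  let Ah := glm_info b X bhat in
  let Bh := X^T *m diagc (hadamard res res) *m X in
  let a := m0 * mB / K in
  let C := 3 / a + KB / a ^+ 2 + 4 / mB in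
  (0 < n)%N -> 0 < K -> cumulant_function b ->
  0 < m0 -> (forall t, m0 <= derive1n 2 b t) ->
  0 < mB -> (forall v, mB * norm2 v ^+ 2 <= quad (n%:R^-1 *: B) v) ->
  0 <= KB -> (forall v, quad (n%:R^-1 *: B) v <= KB * norm2 v ^+ 2) ->
  is_QMLE b X (meanv Y) beta0 -> is_QMLE b X (rvec Y w) bhat ->
  0 < c -> (forall beta, nb beta ->
    c <= lambda_min (invsqrtmx B *m glm_info b X beta *m invsqrtmx B)) ->
  0 < L -> 0 <= rho ->
  lipschitz_opnorm L nb (fun beta => n%:R^-1 *: glm_info b X beta) ->
  lipschitz_opnorm L nb (fun beta => n%:R^-1 *:
    (X^T *m diagc (absv (shift beta)) *m X)) ->
  lipschitz_opnorm L nb (fun beta => n%:R^-1 *: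
    (X^T *m diagc (hadamard (shift beta) (shift beta)) *m X)) ->
  ((0 < d)%N ->
    norm2 (X^T *m (rvec Y w - meanv Y)) < c * rho * n%:R * Num.sqrt mB) ->
  0 <= s -> (forall i, `|err Y i w| <= s) ->
  0 <= tau -> tau <= mB / 4 ->
  d%:R * frob2 (gramw X (fluct Y bi w)) <= (n%:R * tau) ^+ 2 ->
  4 * wnorm X (hadamard bi bi) <= n%:R * tau ->
  4 * (d%:R * (L * (rho / Num.sqrt mB)) * (1 + s)) <= tau ->
  [/\ 0 < \det (invmx A *m B), 0 < \det (invmx Ah *m Bh),
    `|\tr (invmx Ah *m Bh) - \tr (invmx A *m B)| <= C * tau &
    `|ln (\det (invmx Ah *m Bh)) - ln (\det (invmx A *m B))| <= C * tau].
Proof.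
move=> bi nb shift res A Ah Bh a C n0 K0 bc m00 bm mB0 Bc KB0 BK opt0 opth c0
  curv L0 rho0 lipA lip1 lip2 small s0 es tau0 taumB fl wb rad.
have nR : 0 < n%:R :> R by rewrite ltr0n.
have sm0 : 0 < Num.sqrt mB by rewrite sqrtr_gt0.
have Bpsd := score_cov_psd.
have nb0 : nb beta0.
  rewrite /nb /= subrr mulmx0 /norm2 big1 ?sqrtr0 // => i _.
  by rewrite mxE expr0n.
have nbh : nb bhat.
  case: (posnP d) => [dz|dpos]; last first.
    exact: (QMLE_localized bc n0 Bpsd mB0 Bc c0 curv opt0 opth (small dpos)).
  rewrite /nb /= /norm2 big1 ?sqrtr0 // => i _.
  by have := ltn_ord i; rewrite {2}dz.
have dist : norm2 (bhat - beta0) <= rho / Num.sqrt mB.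
  rewrite ler_pdivlMr // mulrC; apply: le_trans nbh.
  exact: nbhd_norm_ge.
set l := L * (rho / Num.sqrt mB) in rad.
have l0 : 0 <= l by rewrite mulr_ge0 ?divr_ge0 // ltW.
have Ldist : L * norm2 (bhat - beta0) <= l by rewrite ler_wpM2l // ltW.
have dl0 : 0 <= d%:R * l by rewrite mulr_ge0.
have Bn v : n%:R * mB * norm2 v ^+ 2 <= quad B v.
  by have := Bc v; rewrite quadZ ler_pdivlMl // mulrA.
have Bop : opbound B (n%:R * KB).
  apply: psd_opbound => //; first by rewrite mulr_ge0 // ltW.
  by move=> v; have := BK v; rewrite quadZ ler_pdivrMl // mulrA.
have a0 : 0 < a by rewrite /a !mulr_gt0 // invr_gt0.
have coer beta v : n%:R * a * norm2 v ^+ 2 <= quad (glm_info b X beta) v.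
  have := glm_info_coercive m00 K0 bm Bn beta v.
  by congr (_ * _ <= _); rewrite /a; ring.
have Aop : opbound (Ah - A) (n%:R * l).
  move=> v; have := opnorm_opbound (n%:R^-1 *: Ah - n%:R^-1 *: A) v.
  have ninv0 : 0 <= n%:R^-1 :> R by rewrite invr_ge0 ltW.
  rewrite -scalerBr -scalemxAl norm2Z (ger0_norm ninv0).
  rewrite ler_pdivrMl // => le1; apply: le_trans le1 _.
  rewrite -mulrA ler_pM2l // ler_wpM2r ?norm2_ge0 //.
  by rewrite scalerBr; apply: le_trans (lipA _ _ nbh nb0) Ldist.
pose sh := shift bhat.
have shift0 : shift beta0 = 0 by rewrite /shift subrr.
have w1 : wnorm X (absv sh) <= n%:R * (d%:R * l).
  apply: le_trans (lipschitz_wnorm n0 lip1 nb0 nbh _ _) _.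
  - by rewrite shift0; apply/colP => i; rewrite !mxE normr0.
  - by move=> i; rewrite mxE.
  - by rewrite ler_pM2l // ler_wpM2l.
have w2 : wnorm X (hadamard sh sh) <= n%:R * (d%:R * l).
  apply: le_trans (lipschitz_wnorm n0 lip2 nb0 nbh _ _) _.
  - by rewrite shift0; apply/colP => i; rewrite !mxE mulr0.
  - by move=> i; rewrite mxE -expr2 sqr_ge0.
  - by rewrite ler_pM2l // ler_wpM2l.
have wrest : wnorm X (rest bi sh (fun i => err Y i w)) <= n%:R * tau.
  apply: le_trans (rest_wnorm X bi sh es) _.
  have h1 : 2 * s * wnorm X (absv sh) <= 2 * s * (n%:R * (d%:R * l)).
    by rewrite ler_wpM2l // mulr_ge0.
  have h2 : n%:R * (4 * (d%:R * l * (1 + s))) <= n%:R * tau by rewrite ler_pM2l.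
  lra.
apply: (sandwich_perturbation (w := rest bi sh (fun i => err Y i w))
   (D := gramw X (fluct Y bi w)) (s := n%:R) (l := l)) => //.
- exact: glm_info_sym.
- exact: glm_info_sym.
- exact: score_cov_sym.
- exact: gramw_sym.
- by apply: coer.
- by apply: coer.
- have : 0 <= d%:R * l * s by rewrite mulr_ge0.
  lra.
- rewrite score_covE /Bh /res (residual_gram X _ (meanv Y) (glm_mean b (X *m beta0)) _ (varv Y)).
  congr (_ + _ + _); last first.
    by congr gramw; apply/colP => i; rewrite /err !mxE.
  by congr gramw; apply/colP => i; rewrite /fluct /err !mxE.
- exact: wrest.
Qed.

End PerSampleSize.

(** * The exceptional event *)

Section BadEvent.
Context {R : realType} {disp : measure_display} {T : measurableType disp}.
Variables (P : probability T R) (n d : nat) (Y : 'I_n -> {RV P >-> R}).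
Variables (X : 'M[R]_(n, d)) (K H : R).
Hypothesis indY : independent_family Y.
Hypothesis sqrY : forall i, ('E_P[fun w => (Y i w ^+ 2)%R] <= K%:E)%E.
Hypothesis varY : forall i, (0 < 'V_P[Y i])%E.
Hypothesis H_gt0 : 0 < H.
Hypothesis tailY : forall (i : 'I_n) (t : R), 0 <= t ->
  (P [set w | (t < `|(invsqrtmx (covmx Y) *m (rvec Y w - meanv Y)) i 0|)%R]
     <= (H * expR (- (t ^+ 2) / H))%:E)%E.

(** The three quantities to be controlled have known means. They are divided
    by their thresholds and added, so that one application of Markov's
    inequality bounds the probability that any of them exceeds its threshold.
    The largest error is read off the sum of the exponentials of the squared
    standardized errors, with threshold [n^2]. *)
Lemma bad_event (bias : 'cV[R]_n) (M t1 t3 : R) :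
  (0 < n)%N -> 0 < K -> (forall i, rowsq X i <= M) -> 0 <= t1 ->
  ((0 < d)%N -> 0 < t1) -> 0 < t3 ->
  exists bad : set T, [/\ measurable bad,
    (P bad <= (\tr (X^T *m covmx Y *m X) / t1 + n%:R^-1 * ((1 + H) * pi)
      + d%:R * (M ^+ 2 * (n%:R * fluct_const K H + 8 * K * \sum_i bias i 0 ^+ 2)) / t3)%:E)%E &
    forall w, ~ bad w -> [/\
      (0 < d)%N -> norm2 (X^T *m (rvec Y w - meanv Y)) ^+ 2 <= t1,
      forall i, `|err Y i w| <= Num.sqrt (4 * H * K * ln n%:R) &
      d%:R * frob2 (gramw X (fluct Y bias w)) <= t3]].
Proof.
move=> n0 K0 XM t10 t1d t30.
have nR : 0 < n%:R :> R by rewrite ltr0n.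
have n2 : 0 < n%:R ^+ 2 :> R by rewrite exprn_gt0.
have H0 := H_gt0.
pose f1 w := norm2 (X^T *m (rvec Y w - meanv Y)) ^+ 2.
pose f2 w := \sum_i expsq Y H i w.
pose f3 w := frob2 (gramw X (fluct Y bias w)).
have [i1 m1] := score_norm_mean X indY sqrY.
have em i := expsq_moment indY sqrY varY H_gt0 tailY i.
have i2 : L1 P f2 by apply: L1_sum => i; have [] := em i.
have m2 : mean P f2 <= n%:R * ((1 + H) * pi).
  rewrite /f2 mean_sum; last by move=> i; have [] := em i.
  have -> : n%:R * ((1 + H) * pi) = \sum_(i < n) (1 + H) * pi :> R.
    by rewrite sumr_const card_ord mulr_natl.
  by apply: ler_sum => i _; have [] := em i.
have [i3 m3] := fluct_gram_mean indY sqrY varY H_gt0 tailY bias XM.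
pose g w := t1^-1 * f1 w + (n%:R ^+ 2)^-1 * f2 w + (d%:R / t3) * f3 w.
have ia := L1Z t1^-1 i1; have ib := L1Z (n%:R ^+ 2)^-1 i2.
have ic := L1Z (d%:R / t3) i3; have iab := L1D ia ib.
have ig : L1 P g := L1D iab ic.
have f10 w : 0 <= t1^-1 * f1 w by rewrite mulr_ge0 ?invr_ge0 ?sqr_ge0.
have f20 w : 0 <= (n%:R ^+ 2)^-1 * f2 w.
  rewrite mulr_ge0 ?invr_ge0 ?(ltW n2) //.
  by apply: sumr_ge0 => i _; apply: expR_ge0.
have f30 w : 0 <= (d%:R / t3) * f3 w.
  by rewrite mulr_ge0 ?frob2_ge0 // divr_ge0 // ltW.
have g0 w : 0 <= g w by rewrite !addr_ge0.
exists [set w | 1 < g w]; split.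
- by apply: measurable_lt_set; apply: L1_measurable ig.
- apply: le_trans (markov_ge0 ig g0 ltr01) _; rewrite lee_fin divr1.
  rewrite /g meanD // meanD // !meanZ // m1.
  apply: lerD; first apply: lerD.
  + by rewrite mulrC.
  + apply: le_trans (ler_wpM2l _ m2) _; first by rewrite invr_ge0 ltW.
    rewrite le_eqVlt; apply/orP; left; apply/eqP; field.
    by rewrite gt_eqF.
  + by rewrite [leRHS]mulrAC ler_wpM2l // divr_ge0 // ltW.
- move=> w /negP; rewrite -leNgt /g => gw.
  have h1 := f10 w; have h2 := f20 w; have h3 := f30 w.
  split.
  + move=> d0; have t1p := t1d d0.
    have : t1^-1 * f1 w <= 1 by lra.
    by rewrite ler_pdivrMl // mulr1.
  + move=> i.
    have : (n%:R ^+ 2)^-1 * f2 w <= 1 by lra.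
    rewrite ler_pdivrMl // mulr1 => f2n.
    have : expsq Y H i w <= n%:R ^+ 2.
      apply: le_trans f2n; rewrite /f2 (bigD1 i) //= lerDl.
      by apply: sumr_ge0 => j _; apply: expR_ge0.
    rewrite /expsq -ler_ln ?posrE ?expR_gt0 // expRK lnXn //.
    rewrite ler_pdivrMr ?mulr_gt0 // => sq.
    rewrite -ler_sqr ?nnegrE ?normr_ge0 ?sqrtr_ge0 // real_normK ?num_real //.
    have ln0 : 0 <= ln (n%:R : R) by rewrite ln_ge0 // ler1n.
    rewrite sqr_sqrtr; last by rewrite !mulr_ge0 // ltW.
    rewrite (err_sqr_std_err sqrY varY).
    have -> : 4 * H * K * ln n%:R = K * ((ln n%:R *+ 2) * (2 * H)) by rewrite -mulr_natr; ring.
    by apply: ler_pM => //; rewrite ?sqr_ge0 ?(varv_le sqrY) ?ltW ?(varv_gt0 sqrY varY).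
  + have : d%:R / t3 * f3 w <= 1 by lra.
    by rewrite mulrAC ler_pdivrMr // mul1r.
Qed.

End BadEvent.

Lemma cvg_probability0 (R : realType) (disp : nat -> measure_display)
    (T : forall n, measurableType (disp n)) (P : forall n, probability (T n) R)
    (A : forall n, set (T n)) :
  (\forall n \near \oo, measurable (A n)) ->
  (forall eta : R, 0 < eta -> \forall n \near \oo, (P n (A n) <= eta%:E)%E) ->
  (fun n => P n (A n)) @ \oo --> (0%E : \bar R).
Proof.
move=> mA small; apply/fine_cvgP; split.
  by apply: filterS mA => n mA; apply: fin_num_measure.
apply/cvgr0Pnorm_le => eta eta0.
near=> n => /=.
have mAn : measurable (A n) by near: n.
have fin : P n (A n) \is a fin_num by apply: fin_num_measure.
rewrite ger0_norm; last by rewrite fine_ge0.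
rewrite -lee_fin fineK //.
by near: n; apply: small.
Unshelve. all: by end_near.
Qed.

(** * Arithmetic of the thresholds *)

Section Arithmetic.
Context {R : realType}.

(** The powers of [n] cancel because the curvature bound is [c1 n^-r] and the
    radius carries [n^r]; what remains is a multiple of [d n ln n]. *)
Lemma localization_threshold (c0 c1 mB r : R) n d : 0 < c0 -> 0 < c1 ->
  0 < mB -> (0 < n)%N -> (0 < d)%N -> 0 < ln (n%:R : R) ->
  c1 ^+ 2 * c0 * mB / 2 * (d%:R * n%:R * ln n%:R)
    < (c1 * n%:R `^ (- r) * ((n%:R / d%:R) `^ (- (1 / 2)) * nbhd_radius c0 r n)
       * n%:R * Num.sqrt mB) ^+ 2.
Proof.
move=> c00 c10 mB0 n0 d0 ln0.
have nR : 0 < n%:R :> R by rewrite ltr0n.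
have dR : 0 < d%:R :> R by rewrite ltr0n.
have nd : 0 < n%:R / d%:R :> R by rewrite divr_gt0.
have half : ((n%:R / d%:R) `^ (- (1 / 2))) ^+ 2 = d%:R / n%:R :> R.
  rewrite -powR_mulrn ?powR_ge0 // -powRrM.
  have -> : - (1 / 2) * 2 = - (1 : R) by field.
  by rewrite powR_inv1 ?ltW // invf_div.
have rr : n%:R `^ (- r) * n%:R `^ r = 1 :> R by rewrite -powR_add // addNr powRr0.
have -> : (c1 * n%:R `^ (- r) * ((n%:R / d%:R) `^ (- (1 / 2)) * nbhd_radius c0 r n)
       * n%:R * Num.sqrt mB) ^+ 2 =
    c1 ^+ 2 * (n%:R `^ (- r) * n%:R `^ r) ^+ 2 * ((n%:R / d%:R) `^ (- (1 / 2))) ^+ 2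
    * (Num.sqrt (c0 * ln n%:R)) ^+ 2 * n%:R ^+ 2 * Num.sqrt mB ^+ 2.
  by rewrite /nbhd_radius; ring.
rewrite rr half (sqr_sqrtr (ltW mB0)) sqr_sqrtr; last by rewrite mulr_ge0 ?ltW.
have -> : c1 ^+ 2 * 1 ^+ 2 * (d%:R / n%:R) * (c0 * ln n%:R) * n%:R ^+ 2 * mB
    = c1 ^+ 2 * c0 * mB * (d%:R * n%:R * ln n%:R).
  by field; rewrite gt_eqF.
have : 0 < c1 ^+ 2 * c0 * mB * (d%:R * n%:R * ln n%:R).
  by rewrite !mulr_gt0 // exprn_gt0.
lra.
Qed.

Lemma bias_rate (C8 alpha r alpha3 : R) n : 0 <= C8 -> (0 < n)%N ->
  alpha3 <= 4 * (r - alpha) ->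
  C8 * n%:R `^ alpha3 <= (Num.sqrt C8 * n%:R `^ (2 * (r - alpha))) ^+ 2.
Proof.
move=> C80 n0 le; have nR : 1 <= n%:R :> R by rewrite ler1n.
rewrite exprMn (sqr_sqrtr C80) ler_wpM2l // -powR_mulrn ?powR_ge0 // -powRrM.
by rewrite ler_powR //; lra.
Qed.

Lemma bias_wnorm_rate (Cx K s8 alpha r : R) n d : (0 < n)%N ->
  d%:R * (Cx * n%:R `^ alpha) ^+ 2
    * (K * (s8 * n%:R `^ (2 * (r - alpha))) * Num.sqrt n%:R)
  = n%:R * (Cx ^+ 2 * K * s8 * (d%:R * n%:R `^ (2 * r - 1 / 2))).
Proof.
move=> n0; have nR : 0 < n%:R :> R by rewrite ltr0n.
have sq : Num.sqrt n%:R = n%:R `^ (1 / 2) :> R by rewrite -powR12_sqrt // div1r.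
have -> : d%:R * (Cx * n%:R `^ alpha) ^+ 2
    * (K * (s8 * n%:R `^ (2 * (r - alpha))) * Num.sqrt n%:R)
  = Cx ^+ 2 * K * s8 * d%:R * (n%:R `^ alpha * n%:R `^ alpha
     * n%:R `^ (2 * (r - alpha)) * Num.sqrt n%:R) by ring.
have -> : n%:R * (Cx ^+ 2 * K * s8 * (d%:R * n%:R `^ (2 * r - 1 / 2))) =
    Cx ^+ 2 * K * s8 * d%:R * (n%:R * n%:R `^ (2 * r - 1 / 2)) by ring.
congr (_ * _).
have -> : n%:R * n%:R `^ (2 * r - 1 / 2) = n%:R `^ (1 + (2 * r - 1 / 2)) :> R.
  by rewrite [RHS]powR_add // (powRr1 (ltW nR)).
rewrite sq -[in LHS]powR_add // -[in LHS]powR_add // -[in LHS]powR_add //.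
by congr powR; field.
Qed.

(** The bias contributes no more than the fourth moments because [2 (r -
    alpha) + 1/2 <= 1]. *)
Lemma fluct_rate (Cx K s8 F alpha r tau : R) n d : (0 < n)%N -> 0 <= s8 ->
  0 <= K -> 0 <= F -> 0 <= alpha -> r < 1 / 4 -> 0 < tau ->
  d%:R * ((d%:R * (Cx * n%:R `^ alpha) ^+ 2) ^+ 2 * (n%:R * F
     + 8 * K * (K * (s8 * n%:R `^ (2 * (r - alpha))) * Num.sqrt n%:R)))
     / (n%:R * tau) ^+ 2
  <= Cx ^+ 4 * (F + 8 * K ^+ 2 * s8) / tau ^+ 2
     * (d%:R ^+ 3 * n%:R `^ (4 * alpha - 1)).
Proof.
move=> n0 s80 K0 F0 a0 r4 tau0.
have nR : 0 < n%:R :> R by rewrite ltr0n.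
have n1 : 1 <= n%:R :> R by rewrite ler1n.
have sq : Num.sqrt n%:R = n%:R `^ (1 / 2) :> R by rewrite -powR12_sqrt // div1r.
have pw : n%:R `^ (2 * (r - alpha)) * Num.sqrt n%:R <= n%:R :> R.
  rewrite sq -powR_add // -[leRHS]powRr1 ?(ltW nR) // ler_powR //.
  lra.
have inner : n%:R * F + 8 * K * (K * (s8 * n%:R `^ (2 * (r - alpha))) * Num.sqrt n%:R)
    <= n%:R * (F + 8 * K ^+ 2 * s8).
  have : 8 * K ^+ 2 * s8 * (n%:R `^ (2 * (r - alpha)) * Num.sqrt n%:R)
      <= 8 * K ^+ 2 * s8 * n%:R.
    by rewrite ler_wpM2l // !mulr_ge0 ?exprn_ge0.
  lra.
have tn : 0 < (n%:R * tau) ^+ 2 by rewrite exprn_gt0 // mulr_gt0.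
rewrite ler_pdivrMr //.
apply: (@le_trans _ _ (d%:R * ((d%:R * (Cx * n%:R `^ alpha) ^+ 2) ^+ 2
    * (n%:R * (F + 8 * K ^+ 2 * s8))))).
  by rewrite ler_wpM2l // ler_wpM2l // sqr_ge0.
have a4 : n%:R `^ (4 * alpha - 1) * n%:R = (n%:R `^ alpha) ^+ 4 :> R.
  have -> : n%:R `^ (4 * alpha - 1) * n%:R = n%:R `^ (4 * alpha - 1 + 1) :> R.
    by rewrite [RHS]powR_add // (powRr1 (ltW nR)).
  by rewrite subrK -powR_mulrn ?powR_ge0 // -powRrM mulrC.
rewrite le_eqVlt; apply/orP; left; apply/eqP.
transitivity (Cx ^+ 4 * (F + 8 * K ^+ 2 * s8) * d%:R ^+ 3
   * (n%:R `^ (4 * alpha - 1) * n%:R) * n%:R).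
  by rewrite a4; ring.
by field; rewrite gt_eqF.
Qed.

End Arithmetic.

(** * Consistency of the plug-in estimator *)

Theorem theorem4 (R : realType) (disp : nat -> measure_display)
    (T : forall n, measurableType (disp n))
    (P : forall n, probability (T n) R)
    (Y : forall n, 'I_n -> {RV (P n) >-> R})
    (nu : forall n, 'I_n -> {sigma_finite_measure set R -> \bar R})
    (g : forall n, 'I_n -> R -> R)
    (kappa : forall n, 'I_n -> R)
    (b : R -> R) (d : nat -> nat) (X : forall n, 'M[R]_(n, d n))
    (beta0 : forall n, 'cV[R]_(d n))
    (betahat : forall n, T n -> 'cV[R]_(d n))
    (H c0 c1 r L alpha2 alpha3 : R) :
  (forall n, independent_family (@Y n)) ->
  (forall n (i : 'I_n), has_density (nu n i) (Y n i) (g n i)) ->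
  (exists K : R, forall n (i : 'I_n),
     ('E_(P n)[fun w => (Y n i w ^+ 2)%R] <= K%:E)%E) ->
  (forall n (i : 'I_n), (0 < 'V_(P n)[Y n i])%E) ->
  (forall n, \rank (X n) = d n) ->
  cumulant_function b ->
  (forall n, glm_normalized b (nu n) (kappa n)) ->
  (forall n, is_KL_minimizer (Y n) b (X n) (kappa n) (g n) (beta0 n)) ->
  (forall n (j : 'I_(d n)),
     measurable_fun setT (fun w => betahat n w j 0)) ->
  (forall n w, is_QMLE b (X n) (rvec (Y n) w) (betahat n w)) ->
  subgaussian_noise Y H ->
  information_growth Y b X beta0 H c0 c1 r ->
  lyapunov_design Y X ->
  lipschitz_information Y b X beta0 c0 r L alpha2 ->
  mean_misspecification Y b X beta0 r alpha2 alpha3 ->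
  eigenvalues_bounded (fun n => n%:R^-1 *: Amx b X beta0 n) ->
  eigenvalues_bounded (fun n => n%:R^-1 *: Bmx Y X n) ->
  (fun n => (d n)%:R : R) =o_\oo (fun n => n%:R `^ ((1 - 4 * r) / 4) : R) ->
  cvg_prob0 P (fun n w =>
    (\tr (Hhat Y b X betahat w) - \tr (Hmx Y b X beta0 n))%:E) /\
  cvg_prob0 P (fun n w =>
    lne (\det (Hhat Y b X betahat w))%:E - lne (\det (Hmx Y b X beta0 n))%:E)%E.
Proof.
move=> indep dens [K0 EK0] varpos rankX bc norm KLmin mbeta qmle [H0 tail]
  [[c10 c00 _ /andP[r0 r4]] curv _ _] _
  [L0 lipA lip1 lip2 [/andP[alpha0 alphar] Xbig]] [/andP[_ a3] missO]
  [mA [KA [mA0 eigA]]] [mB [KB0 [mB0 eigB]]] dsmall.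
have [_ _ _ [m0 m00 bm]] := bc.
pose K : R := `|K0| + 1.
have K_gt0 : 0 < K by rewrite /K ltr_pwDr.
have EK n (i : 'I_n) : ('E_(P n)[fun w => (Y n i w ^+ 2)%R] <= K%:E)%E.
  apply: le_trans (EK0 n i) _; rewrite lee_fin /K.
  by apply: le_trans (ler_norm _) _; rewrite lerDl.
pose KB : R := `|KB0|.
have KB_ge0 : 0 <= KB by apply: normr_ge0.
have EKn n := EK n.
have Bpsd n : psdmx (Bmx Y X n) := score_cov_psd (X n) (@indep n) (EKn n) (varpos n).
have nBs n : (n%:R^-1 *: Bmx Y X n)^T = n%:R^-1 *: Bmx Y X n.
  by rewrite linearZ /= (proj1 (Bpsd n)).
have Blow n v : mB * norm2 v ^+ 2 <= quad (n%:R^-1 *: Bmx Y X n) v.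
  by apply: eigen_quad_ge => // a /eigB /andP[].
have Bup n v : quad (n%:R^-1 *: Bmx Y X n) v <= KB * norm2 v ^+ 2.
  apply: eigen_quad_le => // a /eigB /andP[_ aK].
  by apply: le_trans aK _; apply: ler_norm.
have opt0 n : is_QMLE b (X n) (meanv (Y n)) (beta0 n).
  apply: (KL_minimizer_loglik (@dens n) _ _ (KLmin n)).
    by move=> i; apply: Y_L1 (EKn n) i.
  by move=> i; have [] := norm n i.
have tailn n (i : 'I_n) (t : R) : 0 <= t ->
  (P n [set w | (t < `|(invsqrtmx (covmx (Y n)) *m (rvec (Y n) w - meanv (Y n))) i 0|)%R]
     <= (H * expR (- (t ^+ 2) / H))%:E)%E := @tail n i t.
pose a := m0 * mB / K.
have a_gt0 : 0 < a by rewrite /a !mulr_gt0 // invr_gt0.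
pose C := 3 / a + KB / a ^+ 2 + 4 / mB.
have C_gt0 : 0 < C.
  have h1 : 0 < 3 / a by rewrite divr_gt0.
  have h2 : 0 < 4 / mB by rewrite divr_gt0.
  have h3 : 0 <= KB / a ^+ 2 by rewrite divr_ge0 // exprn_ge0 // ltW.
  by rewrite /C; lra.
have dle := littleo_powR_le dsmall.
have [Cx Cx0 XC] : exists2 Cx, 0 < Cx & \forall n \near \oo,
    mx_norm (X n) <= Cx * n%:R `^ alpha2.
  exact: bigO_powR_le Xbig.
have [C8 C80 missC] : exists2 C8, 0 <= C8 & \forall n \near \oo,
    \sum_i ((meanv (Y n) - glm_mean b (X n *m beta0 n)) i 0 ^+ 2
            / varv (Y n) i 0) ^+ 2 <= C8 * n%:R `^ alpha3.
  have [C8 C80 missC] := bigO_powR_le missO; exists C8; first exact: ltW.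
  apply: filterS missC => n; congr (_ <= _); apply: eq_bigr => i _.
  by rewrite !mxE.
pose rho n : R := (n%:R / (d n)%:R) `^ (- (1 / 2)) * nbhd_radius c0 r n.
(* Half of the constant of [localization_threshold], whose inequality is strict. *)
pose kap : R := c1 ^+ 2 * c0 * mB / 2.
have kap_gt0 : 0 < kap by rewrite /kap !mulr_gt0 // exprn_gt0.
pose ok n (tau : R) (w : T n) :=
  [/\ 0 < \det (Hmx Y b X beta0 n), 0 < \det (Hhat Y b X betahat w),
    `|\tr (Hhat Y b X betahat w) - \tr (Hmx Y b X beta0 n)| <= C * tau &
    `|ln (\det (Hhat Y b X betahat w)) - ln (\det (Hmx Y b X beta0 n))| <= C * tau].
have key (tau eta : R) : 0 < tau -> tau <= mB / 4 -> 0 < eta -> \forall n \near \oo,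
    exists bad : set (T n), [/\ measurable bad, (P n bad <= eta%:E)%E &
      forall w, ~ bad w -> ok n tau w].
  move=> tau0 taumB eta0.
  pose s8 := Num.sqrt C8.
  have s80 : 0 <= s8 by apply: sqrtr_ge0.
  pose F := fluct_const K H.
  have F0 : 0 <= F by apply/fluct_const_ge0/ltW.
  pose G2 := 4 * (Cx ^+ 2 * K * s8) + 1.
  have G20 : 0 < G2.
    rewrite /G2 ltr_wpDl // !mulr_ge0 ?exprn_ge0 // ltW //.
  pose G3 := Cx ^+ 4 * (F + 8 * K ^+ 2 * s8) / tau ^+ 2 + 1.
  have G30 : 0 < G3.
    rewrite /G3 ltr_wpDl // divr_ge0 ?exprn_ge0 ?(ltW tau0) //.
    rewrite mulr_ge0 ?exprn_ge0 ?(ltW Cx0) //.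
    by rewrite addr_ge0 // !mulr_ge0 ?exprn_ge0 // ltW.
  have eta3 : 0 < eta / 3 by rewrite divr_gt0.
  pose e1 := tau / (4 * (L / Num.sqrt mB)).
  have sm0 : 0 < Num.sqrt mB by rewrite sqrtr_gt0.
  have e10 : 0 < e1 by rewrite /e1 divr_gt0 // mulr_gt0 // divr_gt0.
  (* The bounds ln2, nbig and fluctn make each of the three terms of the mean in
     [bad_event] at most eta / 3; rad and biasn keep the remaining errors below
     tau.  G2 and G3 are the constants of the bias and fluctuation rates,
     increased by 1 so that they are positive. *)
  near=> n.
  have n0 : (0 < n)%N by near: n; exists 1%N.
  have nR : 0 < n%:R :> R by rewrite ltr0n.
  have ln1 : 0 < ln (n%:R : R) by near: n; apply: near_ln_gt.
  have ln2 : KB / (kap * (eta / 3)) < ln (n%:R : R) by near: n; apply: near_ln_gt.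
  have nbig : (1 + H) * pi / (eta / 3) < n%:R :> R by near: n; apply: nbhs_infty_gtr.
  have curvn : forall beta : 'cV[R]_(d n), nbhd Y X beta0 c0 r beta ->
    c1 * n%:R `^ (- r) < lambda_min (Vmx Y b X beta) by near: n; exact: curv.
  have Xn : mx_norm (X n) <= Cx * n%:R `^ alpha2 by near: n; exact: XC.
  have missn : \sum_i ((meanv (Y n) - glm_mean b (X n *m beta0 n)) i 0 ^+ 2
            / varv (Y n) i 0) ^+ 2 <= C8 * n%:R `^ alpha3 by near: n; exact: missC.
  have rad : (d n)%:R * rho n * (1 + Num.sqrt ((4 * H * K) * ln n%:R)) < e1.
    near: n; apply: near_radius_small => //.
    by rewrite !mulr_ge0 // ltW.
  have biasn : (d n)%:R * n%:R `^ (2 * r - 1 / 2) < tau / G2.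
    by near: n; apply: near_bias_small => //; rewrite divr_gt0.
  have fluctn : (d n)%:R ^+ 3 * n%:R `^ (4 * alpha2 - 1) < (eta / 3) / G3.
    by near: n; apply: (near_fluct_small r4 alphar dle) => //; rewrite divr_gt0.
  pose bi := meanv (Y n) - glm_mean b (X n *m beta0 n).
  pose M := (d n)%:R * (Cx * n%:R `^ alpha2) ^+ 2.
  have M0 : 0 <= M by rewrite mulr_ge0 ?sqr_ge0.
  have XM := rowsq_le_mx_norm Xn; rewrite -/M in XM.
  pose q := s8 * n%:R `^ (2 * (r - alpha2)).
  have q0 : 0 <= q by rewrite mulr_ge0 ?powR_ge0.
  have biS : \sum_i bi i 0 ^+ 2 <= K * q * Num.sqrt n%:R.
    apply: (bias_sum_le (EKn n) (varpos n)) => //.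
    by apply: le_trans missn _; apply: bias_rate.
  pose t1 := kap * ((d n)%:R * n%:R * ln n%:R).
  have t10 : 0 <= t1 by rewrite !mulr_ge0 // ltW.
  have t1d : (0 < d n)%N -> 0 < t1.
    by move=> d0; rewrite !mulr_gt0 // ltr0n.
  have t30 : 0 < (n%:R * tau) ^+ 2 by rewrite exprn_gt0 // mulr_gt0.
  have [bad [mbad Pbad goodw]] := bad_event (@indep n) (EKn n) (varpos n) H0 (@tailn n)
    bi n0 K_gt0 XM t10 t1d t30.
  exists bad; split=> //.
    apply: le_trans Pbad _; rewrite lee_fin.
    have u1 : \tr (Bmx Y X n) / t1 <= eta / 3.
      (* For d = 0 the threshold t1 is 0, and so is its inverse. *)
      have [d0|d0] := posnP (d n).
        suff -> : t1 = 0 by rewrite invr0 mulr0 ltW.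
        by rewrite /t1 (_ : (d n)%:R = 0 :> R) ?mul0r ?mulr0 // d0.
      rewrite ler_pdivrMr ?t1d //; apply: le_trans (ler_norm _) _.
      have Bop : opbound (Bmx Y X n) (n%:R * KB).
        apply: psd_opbound => //; first by rewrite mulr_ge0.
        by move=> v; have := Bup n v; rewrite quadZ ler_pdivrMl // mulrA.
      apply: le_trans (opbound_trace Bop) _.
      have dn0 : 0 < (d n)%:R * n%:R :> R by rewrite mulr_gt0 // ltr0n.
      have := ltW ln2; rewrite ler_pdivrMr ?mulr_gt0 // => le.
      have := ler_wpM2l (ltW dn0) le.
      suff -> : eta / 3 * t1 = (d n)%:R * n%:R * (ln n%:R * (kap * (eta / 3))).
        by apply: le_trans; rewrite mulrA.
      by rewrite /t1; ring.
    have u2 : n%:R^-1 * ((1 + H) * pi) <= eta / 3.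
      by rewrite ler_pdivrMl // -ler_pdivrMr // ltW.
    have u3 : (d n)%:R * (M ^+ 2 * (n%:R * fluct_const K H + 8 * K * \sum_i bi i 0 ^+ 2))
        / (n%:R * tau) ^+ 2 <= eta / 3.
      apply: (@le_trans _ _ ((d n)%:R * (M ^+ 2 * (n%:R * F
          + 8 * K * (K * q * Num.sqrt n%:R))) / (n%:R * tau) ^+ 2)).
        rewrite ler_pdivrMr // divfK ?gt_eqF //.
        by rewrite ler_wpM2l // ler_wpM2l ?sqr_ge0 // lerD2l ler_wpM2l // mulr_ge0 // ltW.
      apply: le_trans (fluct_rate _ _ n0 s80 (ltW K_gt0) F0 alpha0 r4 tau0) _.
      apply: (@le_trans _ _ (G3 * ((d n)%:R ^+ 3 * n%:R `^ (4 * alpha2 - 1)))).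
        by rewrite ler_wpM2r ?mulr_ge0 ?exprn_ge0 ?powR_ge0 // /G3 lerDl.
      by rewrite mulrC -ler_pdivlMr // ltW.
    have -> : eta = eta / 3 + eta / 3 + eta / 3 by field.
    by apply: lerD => //; apply: lerD.
  move=> w /goodw [g1 g2 g3].
  apply: (@plugin_good_event _ _ _ (P n) n (d n) (Y n) (X n) K (@indep n) (EKn n) (varpos n)
    b (beta0 n) (betahat n w) w m0 mB KB (c1 * n%:R `^ (- r)) (rho n) L
    (Num.sqrt (4 * H * K * ln n%:R)) tau) => //.
  - by rewrite mulr_gt0 // powR_gt0.
  - by move=> beta nbb; apply/ltW/curvn.
  - by rewrite /rho mulr_ge0 ?powR_ge0 // mulr_ge0 ?powR_ge0 ?sqrtr_ge0.
  - move=> d0; rewrite -ltr_sqr ?nnegrE ?norm2_ge0 //.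
      apply: le_lt_trans (g1 d0) _.
      exact: localization_threshold.
    rewrite mulr_ge0 ?sqrtr_ge0 // mulr_ge0 // mulr_ge0 //.
      by rewrite mulr_ge0 ?powR_ge0 // ltW.
    by rewrite /rho mulr_ge0 ?powR_ge0 // mulr_ge0 ?powR_ge0 ?sqrtr_ge0.
  - exact: ltW.
  - have := wnorm_bias_le XM biS M0; rewrite /M /q bias_wnorm_rate //.
    move=> le.
    have le2 : 4 * (Cx ^+ 2 * K * s8 * ((d n)%:R * n%:R `^ (2 * r - 1 / 2))) <= tau.
      apply: (@le_trans _ _ (G2 * ((d n)%:R * n%:R `^ (2 * r - 1 / 2)))).
        have : 0 <= (d n)%:R * n%:R `^ (2 * r - 1 / 2) :> R by rewrite mulr_ge0 ?powR_ge0.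
        have -> : forall y, G2 * y = 4 * (Cx ^+ 2 * K * s8 * y) + y.
          by move=> y; rewrite /G2; ring.
        by rewrite lerDl.
      by rewrite mulrC -ler_pdivlMr // ltW.
    apply: le_trans (ler_wpM2l _ le) _; first by [].
    by rewrite mulrCA ler_wpM2l // ltW.
  - have Ls : 0 < 4 * (L / Num.sqrt mB) by rewrite mulr_gt0 ?divr_gt0.
    move: (ltW rad); rewrite /e1 ler_pdivlMr //.
    by congr (_ <= _); ring.
have mH : \forall n \near \oo, 
    mx_measurable (Hhat Y b X betahat (n := n)) /\ 0 < \det (Hmx Y b X beta0 n).
  near=> n.
  have n0 : (0 < n)%N by near: n; exists 1%N.
  have nR : 0 < n%:R :> R by rewrite ltr0n.
  have Bn v : n%:R * mB * norm2 v ^+ 2 <= quad (Bmx Y X n) v.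
    by have := Blow n v; rewrite quadZ ler_pdivlMl // mulrA.
  have nmB : 0 < n%:R * mB by rewrite mulr_gt0.
  have coer := glm_info_coercive (@indep n) (EKn n) m00 K_gt0 bm Bn.
  have coer0 : 0 < m0 * (n%:R * mB) / K by rewrite !mulr_gt0 // invr_gt0.
  have detA beta : 0 < \det (glm_info b (X n) beta).
    by apply: coercive_det_gt0 (glm_info_sym b (X n) beta) coer0 (coer beta).
  have [mb1 mb2] := cumulant_measurable bc.
  have mXb i : measurable_fun setT (fun w => (X n *m betahat n w) i 0).
    apply: (mx_measurable_mul (mx_measurable_cst (X n))) => k j.
    by rewrite ord1; apply: mbeta.
  split.
    apply: mx_measurable_mul.
      apply: mx_measurable_inv => [|w]; last exact: detA.
      apply: mx_measurable_gramw => i.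
      rewrite (_ : (fun w => _) = (derive1n 2 b) \o (fun w => (X n *m betahat n w) i 0)).
        exact: measurableT_comp.
      by apply/funext => w; rewrite mxE.
    apply: mx_measurable_gramw => i.
    have mres : measurable_fun setT (fun w => residual Y b X betahat w i 0).
      rewrite (_ : (fun w => _) =
        fun w => Y n i w - derive1 b ((X n *m betahat n w) i 0)).
        by apply: measurable_funB => //; apply: measurableT_comp.
      apply/funext => w; rewrite [LHS]mxE [rvec _ _ _ _]mxE.
      by rewrite [Z in _ + Z]mxE [glm_mean _ _ _ _]mxE.
    rewrite (_ : (fun w => _) =
      fun w => residual Y b X betahat w i 0 * residual Y b X betahat w i 0).
      exact: measurable_funM.
    by apply/funext => w; rewrite mxE.
  have detB := coercive_det_gt0 (proj1 (Bpsd n)) nmB Bn.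
  by rewrite det_mulmx det_inv mulr_gt0 // invr_gt0; apply: detA.
have concl (eps : R) : 0 < eps -> exists2 tau, 0 < tau <= mB / 4 & C * tau <= eps.
  move=> eps0; exists (Num.min (mB / 4) (eps / C)).
    by rewrite lt_min !divr_gt0 //= ge_min lexx.
  by rewrite mulrC -ler_pdivlMr // ge_min lexx orbT.
split=> eps eps0; have [tau /andP[tau0 taumB] Ctau] := concl eps eps0;
  apply: cvg_probability0.
- apply: filterS mH => n [mHn _].
  apply: measurable_deviation.
  exact: mx_measurable_trace.
- move=> eta eta0; near=> n.
  have [mHn detH] : mx_measurable (Hhat Y b X betahat (n := n)) /\
      0 < \det (Hmx Y b X beta0 n) by near: n; exact: mH.
  have [bad [mbad Pbad goodw]] : exists bad : set (T n),
      [/\ measurable bad, (P n bad <= eta%:E)%E & forall w, ~ bad w -> ok n tau w].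
    by near: n; apply: key.
  apply: le_trans Pbad; apply: le_measure; rewrite ?inE //.
    by apply: measurable_deviation; apply: mx_measurable_trace.
  move=> w; rewrite /mkset => dev; apply: contrapT => /goodw [_ _ le _].
  by move: dev; rewrite lte_fin ltNge (le_trans le).
- apply: filterS mH => n [mHn detH].
  by apply: measurable_lne_deviation => //; apply: mx_measurable_det.
- move=> eta eta0; near=> n.
  have [mHn detH] : mx_measurable (Hhat Y b X betahat (n := n)) /\
      0 < \det (Hmx Y b X beta0 n) by near: n; exact: mH.
  have [bad [mbad Pbad goodw]] : exists bad : set (T n),
      [/\ measurable bad, (P n bad <= eta%:E)%E & forall w, ~ bad w -> ok n tau w].
    by near: n; apply: key.
  apply: le_trans Pbad; apply: le_measure; rewrite ?inE //.
    by apply: measurable_lne_deviation => //; apply: mx_measurable_det.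
  move=> w; rewrite /mkset => dev; apply: contrapT => /goodw [h1 h2 _ le].
  by move: dev; rewrite !lne_EFin // -EFinB lte_fin ltNge (le_trans le).
Unshelve. all: by end_near.
Qed.
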